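(* A computable linear order $\mathcal{A}$ is computably categorical if and only if $\mathcal{A}$ is weakly ultrahomogeneous.
   Context: Structures are countable. A linear order $(A,<)$ is computable if $A$ is a computable subset of $\omega$ and $<$ is a computable relation. A computable structure $\mathcal{A}$ is computably categorical if every computable structure isomorphic to $\mathcal{A}$ is isomorphic to $\mathcal{A}$ by a computable isomorphism. $\mathcal{A}$ is weakly ultrahomogeneous if there is a finite set $\{a_1,\dots,a_n\}\subseteq A$ such that every isomorphism between finite suborders of $\mathcal{A}$ containing all $a_i$ and fixing each $a_i$ extends to an automorphism of $\mathcal{A}$. *)

(* Defs.v *)
From mathcomp Require Import all_boot.

Set Implicit Arguments.
Unset Strict Implicit.
Unset Printing Implicit Defensive.

(* Mu-recursive programs acting on argument lists. Arities are not tracked by *)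
(* the type: a program is undefined on lists that are too short for it, and   *)
(* superfluous trailing arguments are ignored.                                *)
Inductive prog : Type :=
| Zero
| Succ
| Proj (i : nat)
| Comp (p : prog) (qs : seq prog)
| PRec (p q : prog)
| Mu (p : prog).

Definition pointwise (T U : Type) (R : T -> U -> Prop) :=
  fix pw (s : seq T) (t : seq U) : Prop :=
    match s, t with
    | [::], [::] => True
    | x :: s', y :: t' => R x y /\ pw s' t'
    | _, _ => False
    end.

(* [computes p xs y]: the partial function of [p] is defined at [xs], with    *)
(* value [y]. [PRec p q] recurses on the first argument:                      *)
(*   h(0, xs) = p(xs)   and   h(m + 1, xs) = q(m, h(m, xs), xs);              *)
(* [Mu p] at xs is the least y with p(y, xs) = 0, provided that p(i, xs) is   *)
(* defined for all i < y.                                                     *)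
Fixpoint computes (p : prog) (xs : seq nat) (y : nat) {struct p} : Prop :=
  match p with
  | Zero => y = 0
  | Succ => if xs is x :: _ then y = x.+1 else False
  | Proj i => onth xs i = Some y
  | Comp p qs =>
      exists2 ys, pointwise (fun q => computes q xs) qs ys & computes p ys y
  | PRec p q =>
      if xs is n :: xs' then
        (fix rec (n y : nat) {struct n} : Prop :=
           if n is m.+1 then
             exists2 r, rec m r & computes q [:: m, r & xs'] y
           else computes p xs' y) n y
      else False
  | Mu p =>
      computes p (y :: xs) 0 /\
      (forall i, i < y -> exists k, computes p (i :: xs) k.+1)
  end.

(* Via the coercion of [bool] to [nat], the characteristic function is        *)
(* computed.                                                                  *)
Definition computable_set (D : pred nat) : Prop :=
  exists p, forall x, computes p [:: x] (D x).

Definition computable_rel (r : rel nat) : Prop :=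
  exists p, forall x y, computes p [:: x; y] (r x y).

(* Only the values of [f] on [D] matter: [f] stands for a function with       *)
(* domain [D], which is computable when some partial recursive function       *)
(* agrees with it on [D].                                                     *)
Definition computable_on (D : pred nat) (f : nat -> nat) : Prop :=
  exists p, {in D, forall x, computes p [:: x] (f x)}.

Record linorder := LinOrder {
  carrier : pred nat;
  prec : rel nat;
  prec_carrier : forall x y, prec x y -> (x \in carrier) && (y \in carrier);
  prec_irr : irreflexive prec;
  prec_trans : transitive prec;
  prec_total : {in carrier &, forall x y, x != y -> prec x y || prec y x}
}.

Definition computable_linorder (A : linorder) : Prop :=
  computable_set (carrier A) /\ computable_rel (prec A).

(* [f] restricts to an isomorphism from (X, r) to (Y, s), where r and s are   *)
(* read as relations on X and Y; the values of [f] outside X are irrelevant.  *)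
Definition isomorphism (X : {pred nat}) (r : rel nat)
    (Y : {pred nat}) (s : rel nat) (f : nat -> nat) : Prop :=
  [/\ {in X, forall x, f x \in Y},
      {in X &, injective f},
      {in Y, forall y, exists2 x, x \in X & f x = y} &
      {in X &, forall x y, s (f x) (f y) = r x y}].

Definition lin_iso (A B : linorder) : (nat -> nat) -> Prop :=
  isomorphism (carrier A) (prec A) (carrier B) (prec B).

Definition automorphism (A : linorder) : (nat -> nat) -> Prop := lin_iso A A.

(* It suffices to let B range over linear orders, since a structure           *)
(* isomorphic to a linear order is one.                                       *)
Definition computably_categorical (A : linorder) : Prop :=
  forall B : linorder, computable_linorder B ->
    (exists f, lin_iso A B f) ->
    exists f, lin_iso A B f /\ computable_on (carrier A) f.

(* Finite subsets are given by sequences, whose order and repetitions play no *)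
(* role.                                                                      *)
Definition weakly_ultrahomogeneous (A : linorder) : Prop :=
  exists2 a : seq nat, {subset a <= carrier A} &
    forall (S T : seq nat) (f : nat -> nat),
      {subset S <= carrier A} -> {subset T <= carrier A} ->
      {subset a <= S} -> {subset a <= T} ->
      isomorphism (mem S) (prec A) (mem T) (prec A) f ->
      {in a, forall x, f x = x} ->
      exists2 g, automorphism A g & {in S, g =1 f}.

(* Main.v *)
Require Import Defs.
From mathcomp Require Import all_boot.
From mathcomp Require Import zify.
From Stdlib Require Import Classical ClassicalEpsilon.

Set Implicit Arguments.
Unset Strict Implicit.
Unset Printing Implicit Defensive.

(** Call a linear order almost dense when all but finitely many of its elements
are two-sided limits: they are neither least nor greatest and belong to no
adjacency. Both properties of the theorem are equivalent to this one.

An almost dense order has the extension property that back-and-forth needs: a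
finite partial isomorphism defined on the exceptional points extends to any
further point ([extend]). Since it is decidable whether a finite list of pairs
is a partial isomorphism, the extension can be found by search, and the
back-and-forth construction yields a computable isomorphism
([back_and_forth]). Run between two copies, it gives computable categoricity
([almost_dense_cc]); run inside one order, it extends finite partial
automorphisms ([almost_dense_wuh]).

A weakly ultrahomogeneous order is almost dense ([wuh_almost_dense]): the
parameters cut the order into finitely many intervals, the points of one
interval are alike, and an interval with at least two points must therefore be
dense without endpoints.

The last implication ([cc_almost_dense]) is a finite injury argument. An order
that is not almost dense has infinitely many adjacencies
([almost_dense_or_adj]). We may assume that its elements are the natural
numbers. A second order on the natural numbers is built in stages, together
with the isomorphism between the two finite orders given so far, which is the
only one there is. When program number [e] maps an apparent adjacency of the
first order to an apparent adjacency of the second, the next new element of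
the second order is put in between, and the isomorphism changes for the
elements between this place and the place of the new element of the first
order. Requirement [e] may only do this if the isomorphism does not change at
numbers below [e], so it has a limit once all requirements act finitely
often. That they do, and that they are met, both follow from [diagonal]:
infinitely many adjacencies lie in one interval of the numbers protected from
[e], and if new elements keep entering this interval, then [e] gets its chance
to separate the image of a true adjacency.

The stages have to be computable, and so the file starts with a calculus for
proving computability of functions on numbers, pairs and lists, and with a
universal function. *)

(** * Recursive functions of one and two numbers *)

Definition cnat (f : nat -> nat) := exists p, forall x, computes p [:: x] (f x).
Definition cnat2 (f : nat -> nat -> nat) :=
  exists p, forall x y, computes p [:: x; y] (f x y).

Lemma computes_comp1 p q xs y z :
  computes q xs y -> computes p [:: y] z -> computes (Comp p [:: q]) xs z.
Proof. by move=> hq hp; exists [:: y]. Qed.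

Lemma computes_comp2 p q1 q2 xs y1 y2 z :
  computes q1 xs y1 -> computes q2 xs y2 -> computes p [:: y1; y2] z ->
  computes (Comp p [:: q1; q2]) xs z.
Proof. by move=> h1 h2 hp; exists [:: y1; y2]. Qed.

Lemma cnat_comp f g : cnat f -> cnat g -> cnat (fun x => f (g x)).
Proof.
move=> [p hp] [q hq]; exists (Comp p [:: q]) => x.
exact: computes_comp1 (hq x) (hp _).
Qed.

Lemma cnat_comp2 h f g :
  cnat2 h -> cnat f -> cnat g -> cnat (fun x => h (f x) (g x)).
Proof.
move=> [p hp] [q hq] [r hr]; exists (Comp p [:: q; r]) => x.
exact: computes_comp2 (hq x) (hr x) (hp _ _).
Qed.

Lemma cnat2_comp f h : cnat f -> cnat2 h -> cnat2 (fun x y => f (h x y)).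
Proof.
move=> [p hp] [q hq]; exists (Comp p [:: q]) => x y.
exact: computes_comp1 (hq x y) (hp _).
Qed.

Lemma cnat2_comp2 h f g : cnat2 h -> cnat2 f -> cnat2 g ->
  cnat2 (fun x y => h (f x y) (g x y)).
Proof.
move=> [p hp] [q hq] [r hr]; exists (Comp p [:: q; r]) => x y.
exact: computes_comp2 (hq x y) (hr x y) (hp _ _).
Qed.

Lemma cnat_id : cnat id. Proof. by exists (Proj 0). Qed.
Lemma cnat_succ : cnat succn. Proof. by exists Succ. Qed.
Lemma cnat2_fst : cnat2 (fun x _ => x). Proof. by exists (Proj 0). Qed.
Lemma cnat2_snd : cnat2 (fun _ y => y). Proof. by exists (Proj 1). Qed.

Lemma cnat_const n : cnat (fun _ => n).
Proof.
elim: n => [|n IH]; first by exists Zero.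
exact: cnat_comp cnat_succ IH.
Qed.

Lemma cnat_ext f g : f =1 g -> cnat f -> cnat g.
Proof. by move=> e [p hp]; exists p => x; rewrite -e. Qed.

Lemma cnat2_prec (a : nat -> nat) (g : nat -> nat -> nat -> nat) h :
  cnat a -> (exists p, forall m r x, computes p [:: m; r; x] (g m r x)) ->
  (forall x, h 0 x = a x) -> (forall n x, h n.+1 x = g n (h n x) x) ->
  cnat2 h.
Proof.
move=> [p hp] [q hq] h0 hS; exists (PRec p q) => n x.
elim: n => [|n IH]; first by rewrite h0; apply: hp.
by exists (h n x) => //; rewrite hS.
Qed.

Lemma cnat_mu (g : nat -> nat -> nat) f : cnat2 g ->
  (forall x, g (f x) x = 0) -> (forall x i, i < f x -> g i x <> 0) -> cnat f.
Proof.
move=> [p hp] f0 fmin; exists (Mu p) => x; split; first by have := hp (f x) x; rewrite f0.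
move=> i /fmin gi; exists (g i x).-1.
by have := hp i x; case: (g i x) gi.
Qed.

Lemma cnat2_add : cnat2 addn.
Proof.
apply: (@cnat2_prec id (fun _ r _ => r.+1)) => //; first exact: cnat_id.
by exists (Comp Succ [:: Proj 1]) => m r x; exists [:: r].
Qed.

Lemma cnat_pred : cnat predn.
Proof.
have [p hp] : cnat2 (fun n _ => n.-1).
  apply: (@cnat2_prec (fun=> 0) (fun m _ _ => m)) => //; first exact: cnat_const.
  by exists (Proj 0).
by exists (Comp p [:: Proj 0; Proj 0]) => x; exists [:: x; x].
Qed.

Lemma cnat2_sub : cnat2 subn.
Proof.
have subr : cnat2 (fun n x => x - n).
  apply: (@cnat2_prec id (fun _ r _ => r.-1)); first exact: cnat_id.
  - have [p hp] := cnat_pred.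
    by exists (Comp p [:: Proj 1]) => m r x; exists [:: r].
  - by move=> x; rewrite subn0.
  - by move=> n x; rewrite subnS.
exact: cnat2_comp2 subr cnat2_snd cnat2_fst.
Qed.

(** * Pairs of numbers *)

Fixpoint tri n := if n is m.+1 then tri m + n else 0.

Lemma tri_mono m n : m <= n -> tri m <= tri n.
Proof.
elim: n => [|n IH]; first by case: m.
by rewrite leq_eqVlt => /orP[/eqP-> //|/IH /= h]; lia.
Qed.

Lemma tri_gt n : n < tri n.+1.
Proof. by elim: n => //= n IH; lia. Qed.

Lemma diag_ex z : exists w, z < tri w.+1.
Proof. by exists z; apply: tri_gt. Qed.

(** The number of the diagonal on which Cantor's pairing function [pairn] takes
the value [z]. *)
Definition diag z := ex_minn (diag_ex z).
Definition pairn a b := tri (a + b) + a.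
Definition pfst z := z - tri (diag z).
Definition psnd z := diag z - pfst z.

Lemma diag_pair a b : diag (pairn a b) = a + b.
Proof.
rewrite /diag; case: ex_minnP => w hw wmin.
apply/eqP; rewrite eqn_leq wmin /pairn /=; last lia.
rewrite leqNgt; apply/negP => /tri_mono /=.
by move: hw; rewrite /pairn /=; lia.
Qed.

Lemma pfst_pair a b : pfst (pairn a b) = a.
Proof. by rewrite /pfst diag_pair /pairn; lia. Qed.

Lemma psnd_pair a b : psnd (pairn a b) = b.
Proof. by rewrite /psnd pfst_pair diag_pair; lia. Qed.

Lemma pair_fst_snd z : pairn (pfst z) (psnd z) = z.
Proof.
have : tri (diag z) <= z < tri (diag z).+1.
  rewrite /diag; case: ex_minnP => w hw wmin; rewrite hw andbT.
  case: w hw wmin => // w _ wmin; rewrite leqNgt; apply/negP => /wmin.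
  by rewrite ltnn.
rewrite /psnd /pfst /= => /andP[h1 h2].
by rewrite /pairn subnKC; lia.
Qed.

Lemma leq_pair1 a b : a <= pairn a b.
Proof. exact: leq_addl. Qed.

Lemma leq_pair2 a b : b <= pairn a b.
Proof.
apply: leq_trans (leq_addr _ _); apply: leq_trans (leq_addl a b) _.
by case: (a + b) => // n; apply: tri_gt.
Qed.

Lemma cnat_tri : cnat tri.
Proof.
have [p hp] : cnat2 (fun n _ => tri n).
  apply: (@cnat2_prec (fun=> 0) (fun m r _ => r + m.+1)) => //.
    exact: cnat_const.
  have [p hp] := cnat2_add; exists (Comp p [:: Proj 1; Comp Succ [:: Proj 0]]).
  move=> m r x; exists [:: r; m.+1] => //=; split=> //; split=> //.
  by exists [:: m].
by exists (Comp p [:: Proj 0; Proj 0]) => x; exists [:: x; x].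
Qed.

Lemma cnat2_pair : cnat2 pairn.
Proof.
apply: cnat2_comp2 cnat2_add _ cnat2_fst.
exact: cnat2_comp cnat_tri cnat2_add.
Qed.

Lemma cnat_diag : cnat diag.
Proof.
apply: (@cnat_mu (fun w z => z.+1 - tri w.+1)).
- apply: cnat2_comp2 cnat2_sub _ _; first exact: cnat2_comp cnat_succ cnat2_snd.
  exact: cnat2_comp cnat_tri (cnat2_comp cnat_succ cnat2_fst).
- by move=> z; rewrite /diag; case: ex_minnP => w hw _; lia.
- move=> z i; rewrite /diag; case: ex_minnP => w _ wmin iw /eqP.
  by rewrite subn_eq0 => /wmin; lia.
Qed.

Lemma cnat_pfst : cnat pfst.
Proof.
exact: cnat_comp2 cnat2_sub cnat_id (cnat_comp cnat_tri cnat_diag).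
Qed.

Lemma cnat_psnd : cnat psnd.
Proof. exact: cnat_comp2 cnat2_sub cnat_diag cnat_pfst. Qed.

(** Both branches travel in one argument, which recursion on the condition leaves
unchanged. *)
Lemma cnat2_if : cnat2 (fun c x => if c is 0 then psnd x else pfst x).
Proof.
apply: (@cnat2_prec psnd (fun _ _ x => pfst x)) => //; first exact: cnat_psnd.
by have [p hp] := cnat_pfst; exists (Comp p [:: Proj 2]) => m r x; exists [:: x].
Qed.

Lemma cnat2_iter g : cnat g ->
  cnat2 (fun n z => iter n (fun t => g (pairn (pfst z) t)) (psnd z)).
Proof.
move=> [q hq].
apply: (@cnat2_prec psnd (fun _ r z => g (pairn (pfst z) r))) => //.
  exact: cnat_psnd.
have [p hp] := cnat2_pair; have [p' hp'] := cnat_pfst.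
exists (Comp q [:: Comp p [:: Comp p' [:: Proj 2]; Proj 1]]) => m r z.
apply: computes_comp1 (hq _).
by apply: computes_comp2 (hp _ _) => //; apply: computes_comp1 (hp' _).
Qed.

(** * Computability over encoded data types *)

Class encodable (T : Type) :=
  Encodable { enc : T -> nat; enc_inj : injective enc }.

#[export] Instance enc_nat : encodable nat := @Encodable nat id (@inj_id nat).

Lemma nat_of_bool_inj : injective nat_of_bool. Proof. by do 2!case. Qed.

#[export] Instance enc_bool : encodable bool := Encodable nat_of_bool_inj.

Section EncPairSeq.
Variables (T U : Type) (eT : encodable T) (eU : encodable U).

Lemma enc_pair_inj : injective (fun z : T * U => pairn (enc z.1) (enc z.2)).
Proof.
move=> [x y] [x' y'] /= e; have := congr1 pfst e; have := congr1 psnd e.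
by rewrite !pfst_pair !psnd_pair => e2 e1; rewrite (enc_inj e1) (enc_inj e2).
Qed.

Lemma enc_seq_inj :
  injective (foldr (fun x c => (pairn (@enc T _ x) c).+1) 0).
Proof.
elim=> [|x s IH] [|y t] //= [e]; have := congr1 pfst e; have := congr1 psnd e.
by rewrite !pfst_pair !psnd_pair => e2 e1; rewrite (enc_inj e1) (IH _ e2).
Qed.

End EncPairSeq.

#[export] Instance enc_pair T U (eT : encodable T) (eU : encodable U) :
  encodable (T * U) := Encodable (@enc_pair_inj T U eT eU).

#[export] Instance enc_seq T (eT : encodable T) : encodable (seq T) :=
  Encodable (@enc_seq_inj T eT).

Lemma enc_pairE T U {eT : encodable T} {eU : encodable U} (x : T) (y : U) :
  enc (x, y) = pairn (enc x) (enc y).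
Proof. by []. Qed.

Lemma enc_consE T {eT : encodable T} (x : T) s :
  enc (x :: s) = (pairn (enc x) (enc s)).+1.
Proof. by []. Qed.

Lemma size_enc T {eT : encodable T} (s : seq T) : size s <= enc s.
Proof.
elim: s => //= x s IH; rewrite ltnS; apply: leq_trans IH _; exact: leq_pair2.
Qed.

(** Computability of [f], transported to codes; what [g] does at numbers that are
not codes is left open. *)
Definition cmp (T U : Type) (eT : encodable T) (eU : encodable U) (f : T -> U) :=
  exists2 g, cnat g & forall x, enc (f x) = g (enc x).
Arguments cmp {T U eT eU} f.

Lemma cmp_ext T U {eT : encodable T} {eU : encodable U} (f g : T -> U) :
  f =1 g -> cmp f -> cmp g.
Proof. by move=> e [h hh eh]; exists h => // x; rewrite -e. Qed.

Lemma cmp_cnat f : cmp f <-> cnat f.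
Proof.
by split=> [[g hg e]|hf]; [apply: cnat_ext hg => x; rewrite -e | exists f].
Qed.

Lemma cmp_of_cnat2 (f : nat -> nat -> nat) :
  cnat2 f -> cmp (fun z : nat * nat => f z.1 z.2).
Proof.
move=> hf; exists (fun z => f (pfst z) (psnd z)).
  exact: cnat_comp2 hf cnat_pfst cnat_psnd.
by move=> [x y]; rewrite enc_pairE pfst_pair psnd_pair.
Qed.

Section Closure.
Variables (X T U V : Type).
Context {eX : encodable X} {eT : encodable T} {eU : encodable U} {eV : encodable V}.

Lemma cmp_id : cmp (@id X).
Proof. by exists id => //; apply: cnat_id. Qed.

Lemma cmp_const (t : T) : cmp (fun _ : X => t).
Proof. by exists (fun=> enc t) => //; apply: cnat_const. Qed.

Lemma cmp_comp (g : T -> U) (f : X -> T) :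
  cmp g -> cmp f -> cmp (fun x => g (f x)).
Proof.
move=> [g' hg eg] [f' hf ef]; exists (fun x => g' (f' x)).
  exact: cnat_comp.
by move=> x; rewrite eg ef.
Qed.

Lemma cmp_pair (f : X -> T) (g : X -> U) :
  cmp f -> cmp g -> cmp (fun x => (f x, g x)).
Proof.
move=> [f' hf ef] [g' hg eg]; exists (fun x => pairn (f' x) (g' x)).
  exact: cnat_comp2 cnat2_pair hf hg.
by move=> x; rewrite enc_pairE ef eg.
Qed.

Lemma cmp_comp2 (h : T -> U -> V) (f : X -> T) (g : X -> U) :
  cmp (fun z => h z.1 z.2) -> cmp f -> cmp g -> cmp (fun x => h (f x) (g x)).
Proof.
move=> [h' hh eh] [f' hf ef] [g' hg eg].
exists (fun x => h' (pairn (f' x) (g' x))).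
  exact: cnat_comp hh (cnat_comp2 cnat2_pair hf hg).
by move=> x; rewrite -ef -eg -enc_pairE -eh.
Qed.

Lemma cmp_fst (f : X -> T * U) : cmp f -> cmp (fun x => (f x).1).
Proof.
move=> [f' hf ef]; exists (fun x => pfst (f' x)); first exact: cnat_comp cnat_pfst hf.
by move=> x; rewrite -ef; case: (f x) => a b; rewrite enc_pairE pfst_pair.
Qed.

Lemma cmp_snd (f : X -> T * U) : cmp f -> cmp (fun x => (f x).2).
Proof.
move=> [f' hf ef]; exists (fun x => psnd (f' x)); first exact: cnat_comp cnat_psnd hf.
by move=> x; rewrite -ef; case: (f x) => a b; rewrite enc_pairE psnd_pair.
Qed.

Lemma cmp_proj1 : cmp (@fst X T).
Proof.
exists pfst; first exact: cnat_pfst.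
by move=> [x y]; rewrite enc_pairE pfst_pair.
Qed.

Lemma cmp_proj2 : cmp (@snd X T).
Proof.
exists psnd; first exact: cnat_psnd.
by move=> [x y]; rewrite enc_pairE psnd_pair.
Qed.

Lemma cmp_if (c : X -> bool) (f g : X -> T) :
  cmp c -> cmp f -> cmp g -> cmp (fun x => if c x then f x else g x).
Proof.
move=> [c' hc ec] [f' hf ef] [g' hg eg].
exists (fun x => if c' x is 0 then psnd (pairn (f' x) (g' x))
                 else pfst (pairn (f' x) (g' x))).
  apply: (cnat_comp2 cnat2_if hc).
  exact: cnat_comp2 cnat2_pair hf hg.
by move=> x; rewrite pfst_pair psnd_pair -ec -ef -eg; case: (c x).
Qed.

(** The parameter [x] is carried along by pairing it with the state. *)
Lemma cmp_iter (n : X -> nat) (g : X -> T -> T) (a : X -> T) :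
  cmp n -> cmp (fun z => g z.1 z.2) -> cmp a ->
  cmp (fun x => iter (n x) (g x) (a x)).
Proof.
move=> [n' hn en] [g' hg eg] [a' ha ea].
exists (fun x => iter (n' x) (fun t => g' (pairn (pfst (pairn x (a' x))) t))
                      (psnd (pairn x (a' x)))).
  apply: (cnat_comp2 (cnat2_iter hg) hn).
  exact: cnat_comp2 cnat2_pair cnat_id ha.
move=> x; rewrite pfst_pair psnd_pair -en -ea [enc (n x)]/=.
elim: (n x) => //= k IH; rewrite -IH -enc_pairE.
by rewrite -(eg (x, iter k (g x) (a x))).
Qed.

Lemma cmp_cons (f : X -> T) (s : X -> seq T) :
  cmp f -> cmp s -> cmp (fun x => f x :: s x).
Proof.
move=> [f' hf ef] [s' hs es]; exists (fun x => (pairn (f' x) (s' x)).+1).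
  apply: cnat_comp cnat_succ _; exact: cnat_comp2 cnat2_pair hf hs.
by move=> x; rewrite enc_consE ef es.
Qed.

Lemma cmp_head (d : X -> T) (s : X -> seq T) :
  cmp d -> cmp s -> cmp (fun x => head (d x) (s x)).
Proof.
move=> [d' hd ed] [s' hs es].
exists (fun x => if s' x is 0 then psnd (pairn (pfst (s' x).-1) (d' x))
                 else pfst (pairn (pfst (s' x).-1) (d' x))).
  apply: (cnat_comp2 cnat2_if hs); apply: cnat_comp2 cnat2_pair _ hd.
  exact: cnat_comp cnat_pfst (cnat_comp cnat_pred hs).
move=> x; rewrite pfst_pair psnd_pair -es -ed; case: (s x) => //= y t.
by rewrite pfst_pair.
Qed.

Lemma cmp_behead (s : X -> seq T) : cmp s -> cmp (fun x => behead (s x)).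
Proof.
move=> [s' hs es].
exists (fun x => if s' x is 0 then psnd (pairn (psnd (s' x).-1) 0)
                 else pfst (pairn (psnd (s' x).-1) 0)).
  apply: (cnat_comp2 cnat2_if hs); apply: cnat_comp2 cnat2_pair _ (cnat_const 0).
  exact: cnat_comp cnat_psnd (cnat_comp cnat_pred hs).
move=> x; rewrite pfst_pair psnd_pair -es; case: (s x) => //= y t.
by rewrite psnd_pair.
Qed.

Lemma cmp_nilp (s : X -> seq T) : cmp s -> cmp (fun x => nilp (s x)).
Proof.
move=> [s' hs es]; exists (fun x => 1 - s' x).
  exact: cnat_comp2 cnat2_sub (cnat_const 1) hs.
by move=> x; rewrite -es; case: (s x).
Qed.

End Closure.

Section NatOps.
Variables (X : Type).
Context {eX : encodable X}.

Lemma cmp_succ (f : X -> nat) : cmp f -> cmp (fun x => (f x).+1).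
Proof. by apply: cmp_comp; apply/cmp_cnat/cnat_succ. Qed.

Lemma cmp_pred (f : X -> nat) : cmp f -> cmp (fun x => (f x).-1).
Proof. by apply: cmp_comp; apply/cmp_cnat/cnat_pred. Qed.

Lemma cmp_add (f g : X -> nat) : cmp f -> cmp g -> cmp (fun x => f x + g x).
Proof. by apply: cmp_comp2; apply/cmp_of_cnat2/cnat2_add. Qed.

Lemma cmp_sub (f g : X -> nat) : cmp f -> cmp g -> cmp (fun x => f x - g x).
Proof. by apply: cmp_comp2; apply/cmp_of_cnat2/cnat2_sub. Qed.

Lemma cmp_pfst (f : X -> nat) : cmp f -> cmp (fun x => pfst (f x)).
Proof. by apply: cmp_comp; apply/cmp_cnat/cnat_pfst. Qed.

Lemma cmp_psnd (f : X -> nat) : cmp f -> cmp (fun x => psnd (f x)).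
Proof. by apply: cmp_comp; apply/cmp_cnat/cnat_psnd. Qed.

Lemma cmp_not (f : X -> bool) : cmp f -> cmp (fun x => ~~ f x).
Proof.
move=> hf; apply: (cmp_ext (f := fun x => if f x then false else true)).
  by move=> x; case: (f x).
by apply: cmp_if => //; apply: cmp_const.
Qed.

Lemma cmp_and (f g : X -> bool) : cmp f -> cmp g -> cmp (fun x => f x && g x).
Proof.
move=> hf hg; apply: (@cmp_if _ _ _ _ f g) => //; exact: cmp_const.
Qed.

Lemma cmp_or (f g : X -> bool) : cmp f -> cmp g -> cmp (fun x => f x || g x).
Proof.
move=> hf hg; apply: (@cmp_if _ _ _ _ f (fun=> true) g) => //; exact: cmp_const.
Qed.

Lemma cmp_implb (f g : X -> bool) :
  cmp f -> cmp g -> cmp (fun x => f x ==> g x).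
Proof.
by move=> hf hg; apply: (@cmp_if _ _ _ _ f g (fun=> true)) => //; apply: cmp_const.
Qed.

Lemma cmp_eq (T : eqType) {eT : encodable T} (f g : X -> T) :
  cmp f -> cmp g -> cmp (fun x => f x == g x).
Proof.
move=> [f' hf ef] [g' hg eg].
exists (fun x => 1 - ((f' x - g' x) + (g' x - f' x))).
  apply: cnat_comp2 cnat2_sub (cnat_const 1) _.
  apply: cnat_comp2 cnat2_add _ _; exact: cnat_comp2 cnat2_sub _ _.
move=> x; rewrite -ef -eg -(inj_eq enc_inj) [LHS]/=.
by case: eqP => e /=; lia.
Qed.

Lemma cmp_leq (f g : X -> nat) : cmp f -> cmp g -> cmp (fun x => f x <= g x).
Proof.
move=> hf hg; apply: cmp_eq; [exact: cmp_sub|exact: cmp_const].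
Qed.

End NatOps.

Section SeqOps.
Variables (X T U : Type).
Context {eX : encodable X} {eT : encodable T} {eU : encodable U}.

(** The code of the list serves as data and also as the number of iterations: it
bounds the length, and the extra steps on the empty list change nothing. *)
Lemma cmp_foldl (g : X -> U -> T -> U) (a : X -> U) (s : X -> seq T) :
  cmp (fun z : X * (U * T) => g z.1 z.2.1 z.2.2) -> cmp a -> cmp s ->
  cmp (fun x => foldl (g x) (a x) (s x)).
Proof.
move=> [g' hg eg] ha [s' hs es].
pose stp (x r : nat) :=
  if pfst r is 0 then psnd (pairn (pairn (psnd (pfst r).-1)
      (g' (pairn x (pairn (psnd r) (pfst (pfst r).-1))))) r)
  else pfst (pairn (pairn (psnd (pfst r).-1)
      (g' (pairn x (pairn (psnd r) (pfst (pfst r).-1))))) r).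
have hstp : cmp (fun z : nat * nat => stp z.1 z.2).
  apply: cmp_of_cnat2; rewrite /stp.
  have hfst f : cnat2 f -> cnat2 (fun x y => pfst (f x y)) by apply: cnat2_comp cnat_pfst.
  have hsnd f : cnat2 f -> cnat2 (fun x y => psnd (f x y)) by apply: cnat2_comp cnat_psnd.
  have hpd f : cnat2 f -> cnat2 (fun x y => (f x y).-1) by apply: cnat2_comp cnat_pred.
  have hpr f h : cnat2 f -> cnat2 h -> cnat2 (fun x y => pairn (f x y) (h x y)).
    exact: cnat2_comp2 cnat2_pair.
  have hy := cnat2_snd; have hx := cnat2_fst.
  apply: (cnat2_comp2 cnat2_if) => //; first exact: hfst.
  apply: (hpr) => //; apply: (hpr); first by apply: (hsnd); apply: (hpd); apply: (hfst).
  apply: (cnat2_comp hg); apply: (hpr) => //; apply: (hpr); first exact: hsnd.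
  by apply: (hfst); apply: (hpd); apply: (hfst).
case: ha => a' ha ea.
have [h hh eh] : cmp (fun x => psnd (iter (s' x) (stp x) (pairn (s' x) (a' x)))).
  apply: cmp_psnd; apply: cmp_iter => //; apply/cmp_cnat => //.
  exact: cnat_comp2 cnat2_pair hs ha.
exists h => // x; rewrite -(eh (enc x)) [RHS]/=.
rewrite -es -ea.
have gen : forall (t : seq T) (u : U) n, size t <= n ->
    enc (foldl (g x) u t) = psnd (iter n (stp (enc x)) (pairn (enc t) (enc u))).
  elim=> [|y t IH] u n le.
    change (enc u = psnd (iter n (stp (enc x)) (pairn 0 (enc u)))).
    have -> : iter n (stp (enc x)) (pairn 0 (enc u)) = pairn 0 (enc u).
      by elim: n {le} => //= n ->; rewrite /stp pfst_pair psnd_pair.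
    by rewrite psnd_pair.
  case: n le => // n /IH {}IH; rewrite iterSr [stp _ _]/stp enc_consE.
  by rewrite !pfst_pair !psnd_pair /= IH (eg (x, (u, y))).
exact/gen/size_enc.
Qed.

End SeqOps.

Section SeqOps2.
Variables (X T U : Type).
Context {eX : encodable X} {eT : encodable T} {eU : encodable U}.

Lemma cmp_rev (s : X -> seq T) : cmp s -> cmp (fun x => rev (s x)).
Proof.
move=> hs; apply: (cmp_ext (f := fun x => foldl (fun u t => t :: u) [::] (s x))).
  move=> x; rewrite /rev; elim: (s x) [::] => //= y t IH u; exact: IH.
apply: (cmp_foldl (g := fun _ u t => t :: u)) => //; last exact: cmp_const.
by apply: cmp_cons; [apply: cmp_snd|apply: cmp_fst]; apply: cmp_snd; apply: cmp_id.
Qed.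

Lemma cmp_foldr (g : X -> T -> U -> U) (a : X -> U) (s : X -> seq T) :
  cmp (fun z : X * (T * U) => g z.1 z.2.1 z.2.2) -> cmp a -> cmp s ->
  cmp (fun x => foldr (g x) (a x) (s x)).
Proof.
move=> hg ha hs.
apply: (cmp_ext (f := fun x => foldl (fun u t => g x t u) (a x) (rev (s x)))).
  by move=> x; rewrite foldl_rev.
apply: (cmp_foldl (g := fun x u t => g x t u)) => //; last exact: cmp_rev.
have swap : cmp (fun z : X * (U * T) => (z.1, (z.2.2, z.2.1))).
  apply: cmp_pair; first by apply: cmp_fst; apply: cmp_id.
  by apply: cmp_pair; [apply: cmp_snd|apply: cmp_fst]; apply: cmp_snd; apply: cmp_id.
exact: (cmp_comp hg swap).
Qed.

End SeqOps2.

Ltac cmp_base := repeat lazymatch goal with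
  | |- cmp (fun x => x) => exact: cmp_id
  | |- cmp (fun _ => ?c) => exact: cmp_const
  | |- cmp (@fst _ _) => exact: cmp_proj1
  | |- cmp (@snd _ _) => exact: cmp_proj2
  | |- cmp (fun x => (_, _)) => eapply cmp_pair
  | |- cmp (fun x => fst _) => eapply cmp_fst
  | |- cmp (fun x => snd _) => eapply cmp_snd
  | |- cmp (fun x => _ :: _) => eapply cmp_cons
  | |- cmp (fun x => S _) => eapply cmp_succ
  | |- cmp (fun x => if _ then _ else _) => eapply cmp_if
  | |- _ => assumption
  end.

Section SeqOps3.
Variables (X T U : Type).
Context {eX : encodable X} {eT : encodable T} {eU : encodable U}.

Lemma cmp_map (f : X -> T -> U) (s : X -> seq T) :
  cmp (fun z : X * T => f z.1 z.2) -> cmp s ->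
  cmp (fun x => [seq f x y | y <- s x]).
Proof.
move=> hf hs; apply: (cmp_foldr (g := fun x y u => f x y :: u)) => //.
  apply: cmp_cons; last by cmp_base.
  by apply: (cmp_comp2 (h := f)); cmp_base.
exact: cmp_const.
Qed.

Lemma cmp_filter (f : X -> T -> bool) (s : X -> seq T) :
  cmp (fun z : X * T => f z.1 z.2) -> cmp s ->
  cmp (fun x => [seq y <- s x | f x y]).
Proof.
move=> hf hs.
apply: (cmp_foldr (g := fun x y u => if f x y then y :: u else u)) => //.
  by apply: cmp_if; [apply: (cmp_comp2 (h := f))| |]; cmp_base.
exact: cmp_const.
Qed.

Lemma cmp_size (s : X -> seq T) : cmp s -> cmp (fun x => size (s x)).
Proof.
move=> hs; apply: (cmp_foldr (g := fun _ _ u => u.+1)) => //; cmp_base.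
Qed.

Lemma cmp_count (f : X -> T -> bool) (s : X -> seq T) :
  cmp (fun z : X * T => f z.1 z.2) -> cmp s -> cmp (fun x => count (f x) (s x)).
Proof.
move=> hf hs; apply: (cmp_ext (f := fun x => size [seq y <- s x | f x y])).
  by move=> x; rewrite size_filter.
exact/cmp_size/cmp_filter.
Qed.

Lemma cmp_all (f : X -> T -> bool) (s : X -> seq T) :
  cmp (fun z : X * T => f z.1 z.2) -> cmp s -> cmp (fun x => all (f x) (s x)).
Proof.
move=> hf hs; apply: (cmp_foldr (g := fun x y u => f x y && u)) => //.
  by apply: cmp_and; [apply: (cmp_comp2 (h := f))|]; cmp_base.
exact: cmp_const.
Qed.

Lemma cmp_has (f : X -> T -> bool) (s : X -> seq T) :
  cmp (fun z : X * T => f z.1 z.2) -> cmp s -> cmp (fun x => has (f x) (s x)).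
Proof.
move=> hf hs; apply: (cmp_foldr (g := fun x y u => f x y || u)) => //.
  by apply: cmp_or; [apply: (cmp_comp2 (h := f))|]; cmp_base.
exact: cmp_const.
Qed.

Lemma cmp_cat (s t : X -> seq T) : cmp s -> cmp t -> cmp (fun x => s x ++ t x).
Proof.
move=> hs ht; apply: (cmp_ext (f := fun x => foldr cons (t x) (s x))).
  by move=> x; elim: (s x) => //= y u ->.
apply: (cmp_foldr (g := fun _ => cons)) => //; cmp_base.
Qed.

End SeqOps3.

Section SeqOps4.
Variables (X T : Type).
Context {eX : encodable X} {eT : encodable T}.

Lemma cmp_flatten (s : X -> seq (seq T)) : cmp s -> cmp (fun x => flatten (s x)).
Proof.
move=> hs; apply: (cmp_foldr (g := fun _ => cat)) => //; last exact: cmp_const.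
by apply: cmp_cat; cmp_base.
Qed.

Lemma cmp_drop (n : X -> nat) (s : X -> seq T) :
  cmp n -> cmp s -> cmp (fun x => drop (n x) (s x)).
Proof.
move=> hn hs; apply: (cmp_ext (f := fun x => iter (n x) behead (s x))).
  move=> x; elim: (n x) (s x) => [|k IH] u; first by rewrite drop0.
  by rewrite iterSr IH; case: u => //=; rewrite !drop_oversize.
apply: (cmp_iter (g := fun _ => behead)) => //.
by apply: cmp_behead; cmp_base.
Qed.

Lemma cmp_nth (d : X -> T) (s : X -> seq T) (n : X -> nat) :
  cmp d -> cmp s -> cmp n -> cmp (fun x => nth (d x) (s x) (n x)).
Proof.
move=> hd hs hn; apply: (cmp_ext (f := fun x => head (d x) (drop (n x) (s x)))).
  by move=> x; rewrite -nth0 nth_drop addn0.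
by apply: cmp_head => //; apply: cmp_drop.
Qed.

Lemma cmp_iota (n : X -> nat) : cmp n -> cmp (fun x => iota 0 (n x)).
Proof.
move=> hn.
apply: (cmp_ext (f := fun x => iter (n x) (fun l => l ++ [:: size l]) [::])).
  by move=> x; elim: (n x) => // k IH; rewrite iterS IH size_iota -[k.+1]addn1 iotaD.
apply: (cmp_iter (g := fun (_ : X) (l : seq nat) => l ++ [:: size l])) => //;
  last exact: cmp_const.
by apply: cmp_cat; cmp_base; apply: cmp_size; cmp_base.
Qed.

End SeqOps4.

Section SeqOps5.
Variables (X : Type).
Context {eX : encodable X}.

Lemma cmp_index (T : eqType) {eT : encodable T} (y : X -> T) (s : X -> seq T) :
  cmp y -> cmp s -> cmp (fun x => index (y x) (s x)).
Proof.
move=> hy hs; apply: (cmp_ext (f := fun x =>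
    foldr (fun z u => if z == y x then 0 else u.+1) 0 (s x))).
  by move=> x; elim: (s x) => //= z t ->.
apply: (cmp_foldr (g := fun x z u => if z == y x then 0 else u.+1)) => //.
  apply: cmp_if; [apply: cmp_eq|..]; cmp_base.
  by apply: (cmp_comp hy); cmp_base.
exact: cmp_const.
Qed.

Lemma cmp_mem (T : eqType) {eT : encodable T} (y : X -> T) (s : X -> seq T) :
  cmp y -> cmp s -> cmp (fun x => y x \in s x).
Proof.
move=> hy hs; apply: (cmp_ext (f := fun x => has (fun z => z == y x) (s x))).
  by move=> x; rewrite -has_pred1; apply: eq_has => z.
apply: (cmp_has (f := fun x z => z == y x)) => //.
by apply: cmp_eq; cmp_base; apply: (cmp_comp hy); cmp_base.
Qed.

Lemma cmp_take T {eT : encodable T} (n : X -> nat) (s : X -> seq T) :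
  cmp n -> cmp s -> cmp (fun x => take (n x) (s x)).
Proof.
move=> hn hs.
apply: (cmp_ext (f := fun x => rev (drop (size (s x) - n x) (rev (s x))))).
  by move=> x; rewrite -{1}[s x]revK size_rev -take_rev revK.
by apply/cmp_rev/cmp_drop; [apply/cmp_sub => //; apply/cmp_size|apply/cmp_rev].
Qed.

Lemma cmp_zip T U {eT : encodable T} {eU : encodable U} (d : T) (d' : U)
    (s : X -> seq T) (t : X -> seq U) :
  cmp s -> cmp t -> cmp (fun x => zip (s x) (t x)).
Proof.
move=> hs ht; apply: (cmp_ext (f := fun x =>
    [seq (nth d (s x) i, nth d' (t x) i) |
       i <- iota 0 (size (s x) - (size (s x) - size (t x)))])).
  move=> x; rewrite -minnE.
  apply: (@eq_from_nth _ (d, d')) => [|i]; rewrite size_map size_iota.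
    by rewrite size_zip.
  move=> lt; rewrite (nth_map 0) ?size_iota // nth_iota // add0n.
  by rewrite nth_zip_cond size_zip lt.
apply: (cmp_map (f := fun x i => (nth d (s x) i, nth d' (t x) i))).
  apply: cmp_pair; (apply: cmp_nth; cmp_base).
    by apply: (cmp_comp hs); cmp_base.
  by apply: (cmp_comp ht); cmp_base.
by apply: cmp_iota; apply: cmp_sub; [|apply: cmp_sub]; apply: cmp_size.
Qed.

End SeqOps5.

(** One rule for each head symbol. The dispatch on the head is what keeps
unification of the function argument first-order and fast. *)
Ltac cmp_step := lazymatch goal with
  | |- cmp (fun x => x) => exact: cmp_id
  | |- cmp (fun _ => ?c) => exact: cmp_const
  | |- cmp (@fst _ _) => exact: cmp_proj1
  | |- cmp (@snd _ _) => exact: cmp_proj2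
  | |- cmp S => exact/cmp_cnat/cnat_succ
  | |- cmp (fun x => (_, _)) => eapply cmp_pair
  | |- cmp (fun x => fst _) => eapply cmp_fst
  | |- cmp (fun x => snd _) => eapply cmp_snd
  | |- cmp (fun x => _ :: _) => eapply cmp_cons
  | |- cmp (fun x => S _) => eapply cmp_succ
  | |- cmp (fun x => predn _) => eapply cmp_pred
  | |- cmp (fun x => if _ then _ else _) => eapply cmp_if
  | |- cmp (fun x => addn _ _) => eapply cmp_add
  | |- cmp (fun x => subn _ _) => eapply cmp_sub
  | |- cmp (fun x => leq _ _) => eapply cmp_leq
  | |- cmp (fun x => pfst _) => eapply cmp_pfst
  | |- cmp (fun x => psnd _) => eapply cmp_psnd
  | |- cmp (fun x => _ && _) => eapply cmp_and
  | |- cmp (fun x => _ || _) => eapply cmp_or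
  | |- cmp (fun x => _ ==> _) => eapply cmp_implb
  | |- cmp (fun x => ~~ _) => eapply cmp_not
  | |- cmp (fun x => _ == _) => eapply cmp_eq
  | |- cmp (fun x => head _ _) => eapply cmp_head
  | |- cmp (fun x => behead _) => eapply cmp_behead
  | |- cmp (fun x => nilp _) => eapply cmp_nilp
  | |- cmp (fun x => map _ _) => eapply cmp_map
  | |- cmp (fun x => filter _ _) => eapply cmp_filter
  | |- cmp (fun x => size _) => eapply cmp_size
  | |- cmp (fun x => count _ _) => eapply cmp_count
  | |- cmp (fun x => all _ _) => eapply cmp_all
  | |- cmp (fun x => has _ _) => eapply cmp_has
  | |- cmp (fun x => _ ++ _) => eapply cmp_cat
  | |- cmp (fun x => flatten _) => eapply cmp_flatten
  | |- cmp (fun x => drop _ _) => eapply cmp_drop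
  | |- cmp (fun x => take _ _) => eapply cmp_take
  | |- cmp (fun x => nth _ _ _) => eapply cmp_nth
  | |- cmp (fun x => iota 0 _) => eapply cmp_iota
  | |- cmp (fun x => index _ _) => eapply cmp_index
  | |- cmp (fun x => _ \in _) => eapply cmp_mem
  end.
Ltac cmp_auto := repeat first [cmp_step | assumption]; cbn beta.

(** * Decoding and unbounded search *)

(** Types for which every number is a code, so that numbers can be used to
enumerate them. *)
Class fullcode (T : Type) {eT : encodable T} :=
  FullCode { dec : nat -> T; decK : forall n, enc (dec n) = n }.
Arguments fullcode T {eT}.

#[export] Instance full_nat : fullcode nat := @FullCode nat _ id (fun=> erefl).

#[export] Instance full_pair T U {eT : encodable T} {eU : encodable U}
    {fT : fullcode T} {fU : fullcode U} : fullcode (T * U).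
Proof.
exists (fun n => (dec (pfst n), dec (psnd n))) => n.
by rewrite enc_pairE !decK pair_fst_snd.
Defined.

Fixpoint decseq T {eT : encodable T} {fT : fullcode T} (fuel n : nat) : seq T :=
  if fuel is k.+1 then
    if n is m.+1 then dec (pfst m) :: decseq k (psnd m) else [::]
  else [::].

#[export] Instance full_seq T {eT : encodable T} {fT : fullcode T} :
  fullcode (seq T).
Proof.
exists (fun n => decseq n n) => n.
have gen : forall k m, m <= k -> enc (decseq (T := T) k m) = m.
  elim=> [|k IH] [|m] // le.
  rewrite [decseq _ _]/= enc_consE decK IH ?pair_fst_snd //.
  by rewrite -ltnS; apply: leq_trans le; rewrite ltnS -{2}[m]pair_fst_snd leq_pair2.
exact: gen.
Qed.

Lemma cmp_dec T {eT : encodable T} {fT : fullcode T} : cmp (@dec T eT fT).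
Proof. by exists id; [exact: cnat_id | move=> n; rewrite decK]. Qed.

Lemma encK T {eT : encodable T} {fT : fullcode T} (x : T) : dec (enc x) = x.
Proof. by apply: (@enc_inj _ eT); rewrite decK. Qed.

(** The search has to stop at every number, not only at codes; this is why all
numbers must be codes here. *)
Lemma cmp_search X {eX : encodable X} {fX : fullcode X} (P : X -> nat -> bool)
    (exP : forall x, exists n, P x n) :
  cmp (fun z => P z.1 z.2) -> cmp (fun x => ex_minn (exP x)).
Proof.
move=> [g hg eg]; exists (fun c => ex_minn (exP (dec c))); last first.
  by move=> x; rewrite encK.
have gE c n : g (pairn c n) = P (dec c) n :> nat.
  by have := eg (@dec _ _ fX c, n); rewrite enc_pairE decK => <-.
apply: (@cnat_mu (fun n c => 1 - g (pairn c n))).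
- apply: cnat2_comp2 cnat2_sub _ _.
    exact: cnat2_comp (cnat_const 1) cnat2_fst.
  exact: cnat2_comp hg (cnat2_comp2 cnat2_pair cnat2_snd cnat2_fst).
- by move=> c; rewrite gE; case: ex_minnP => n ->.
- move=> c i; rewrite gE; case: ex_minnP => n _ nmin lt.
  by case: (boolP (P _ i)) => // /nmin; rewrite leqNgt lt.
Qed.

(** * A universal function *)

(** Induction with a hypothesis for each program in the list of [Comp], which the
generated principle does not have. *)
Fixpoint prog_ind' (P : prog -> Prop) (H0 : P Zero) (H1 : P Succ)
    (H2 : forall i, P (Proj i))
    (H3 : forall p qs, P p -> (forall j, j < size qs -> P (nth Zero qs j)) ->
          P (Comp p qs))
    (H4 : forall p q, P p -> P q -> P (PRec p q))
    (H5 : forall p, P p -> P (Mu p)) (p : prog) {struct p} : P p :=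
  let rec := prog_ind' H0 H1 H2 H3 H4 H5 in
  match p with
  | Zero => H0
  | Succ => H1
  | Proj i => H2 i
  | Comp p qs => H3 p qs (rec p)
      ((fix on_seq qs : forall j, j < size qs -> P (nth Zero qs j) :=
          match qs with
          | [::] => fun j lt => False_ind _ (notF lt)
          | q :: qs' => fun j =>
              match j with 0 => fun=> rec q | k.+1 => on_seq qs' k end
          end) qs)
  | PRec p q => H4 p q (rec p) (rec q)
  | Mu p => H5 p (rec p)
  end.

Fixpoint code (p : prog) : nat :=
  match p with
  | Zero => pairn 0 0
  | Succ => pairn 1 0
  | Proj i => pairn 2 i
  | Comp p qs => pairn 3 (pairn (code p) (enc [seq code q | q <- qs]))
  | PRec p q => pairn 4 (pairn (code p) (code q))
  | Mu p => pairn 5 (code p)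
  end.

Arguments enc {T encodable} _ : simpl never.
Arguments dec {T eT fullcode} _ : simpl never.

(** [(code p, (xs, y))] stands for [computes p xs y]. *)
Definition fact := (nat * (seq nat * nat))%type.

(** One step of a derivation: [f] follows from facts in [T] by the clause of
[computes] for its program. Intermediate values are read off from [T], so that
all quantifiers are bounded. *)
Definition just (T : seq fact) (f : fact) : bool :=
  let c := f.1 in let xs := f.2.1 in let y := f.2.2 in
  let a := psnd c in
  if pfst c == 0 then y == 0
  else if pfst c == 1 then ~~ nilp xs && (y == (head 0 xs).+1)
  else if pfst c == 2 then (a < size xs) && (y == nth 0 xs a)
  else if pfst c == 3 then
    has (fun t : fact =>
      [&& t.1 == pfst a, t.2.2 == y,
          size t.2.1 == size (dec (psnd a) : seq nat) &
          all (fun j => (nth 0 (dec (psnd a) : seq nat) j, (xs, nth 0 t.2.1 j)) \in T)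
              (iota 0 (size t.2.1))]) T
  else if pfst c == 4 then
    ~~ nilp xs &&
    (if head 0 xs == 0 then (pfst a, (behead xs, y)) \in T
     else has (fun t : fact =>
       [&& t.1 == c, t.2.1 == (head 0 xs).-1 :: behead xs &
           (psnd a, ((head 0 xs).-1 :: t.2.2 :: behead xs, y)) \in T]) T)
  else if pfst c == 5 then
    ((a, (y :: xs, 0)) \in T) &&
    all (fun i => has (fun t : fact =>
      [&& t.1 == a, t.2.1 == i :: xs & 0 < t.2.2]) T) (iota 0 y)
  else false.

(** Each fact may only use later ones; soundness is then an induction on the list,
whatever the programs are. *)
Definition check (T : seq fact) : bool :=
  all (fun i => just (drop i.+1 T) (nth (0, ([::], 0)) T i)) (iota 0 (size T)).

Lemma cmp_just : cmp (fun z : seq fact * fact => just z.1 z.2).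
Proof.
rewrite /just; cmp_auto.
all: by apply: (cmp_comp cmp_dec); cmp_auto.
Qed.

Lemma cmp_check : cmp check.
Proof.
rewrite /check; cmp_auto; last exact/cmp_size/cmp_id.
by apply: (cmp_comp2 cmp_just); cmp_auto.
Qed.

Lemma check_cons f T : check (f :: T) = just T f && check T.
Proof.
rewrite /check /= drop0 -[1]addn0 iotaDl all_map; congr (_ && _).
Qed.

Lemma pointwise_nth T U (d : T) (d' : U) (R : T -> U -> Prop) s t :
  pointwise R s t <->
  size s = size t /\ (forall j, j < size s -> R (nth d s j) (nth d' t j)).
Proof.
elim: s t => [|x s IH] [|y t] //=; try by split=> // -[].
split=> [[h /IH [e r]]|[[e] r]].
  by rewrite e; split=> // -[|j] //; rewrite -e; apply: r.
split; first exact: (r 0).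
by apply/IH; split=> // j; apply: (r j.+1).
Qed.

Lemma check_sound T p xs y : check T -> (code p, (xs, y)) \in T -> computes p xs y.
Proof.
elim: T p xs y => // f T IH p xs y; rewrite check_cons => /andP[jf cT].
rewrite in_cons => /orP[/eqP ef|]; last exact: IH.
move: jf; rewrite -{}ef /just /= => {f}.
have {cT} IH q ys z := IH q ys z cT.
case: p => [||i|p qs|p q|p] /=; rewrite ?(pfst_pair, psnd_pair) /=.
- by move/eqP.
- by case: xs => //= x xs /eqP.
- case/andP=> lt /eqP->; elim: i xs lt => [|i IHi] [|x xs] //; exact: IHi.
- case/hasP=> -[c [ys z]] tT /= /and4P[/eqP ec /eqP ez sz /allP al].
  exists ys; last by rewrite -ez; apply: IH; rewrite -ec.
  apply/(pointwise_nth Zero 0); move: sz al; rewrite encK size_map => /eqP sz al.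
  split=> // j lt; apply: IH; rewrite -(nth_map _ 0) //; apply: al.
  by rewrite mem_iota sz.
- case: xs => [|[|m] xs] //=; first exact: IH.
  case/hasP=> -[c [ys r]] tT /= /and3P[/eqP ec /eqP eys h].
  exists r; last exact: IH h.
  by apply: (IH (PRec p q) (m :: xs)); rewrite /= -ec -eys.
- case/andP=> /IH h0 /allP h; split=> // i lt.
  have /h/hasP[[c [ys k]] tT /= /and3P[/eqP ec /eqP eys k0]] : i \in iota 0 y.
    by rewrite mem_iota.
  by exists k.-1; apply: IH; rewrite prednK // -ec -eys.
Qed.

Lemma just_mono T T' f : {subset T <= T'} -> just T f -> just T' f.
Proof.
move=> sub; rewrite /just.
have sub' (P Q : pred fact) : subpred P Q -> has P T -> has Q T'.
  by move=> PQ /hasP[t /sub tT /PQ Qt]; apply/hasP; exists t.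
do 3 (case: ifP => // _).
case: ifP => _.
  apply: sub' => t /and4P[-> -> ->] /allP h /=; apply/allP => j /h; exact: sub.
case: ifP => _.
  case/andP=> -> /=; case: ifP => _; first exact: sub.
  by apply: sub' => t /and3P[-> ->] /=; exact: sub.
case: ifP => // _ /andP[/sub-> /allP h] /=.
by apply/allP => i /h; apply: sub'.
Qed.

Definition derivable f := exists2 T, check T & f \in T.

(** Derivations can be concatenated. *)
Lemma derivable_all (fs : seq fact) :
  (forall f, f \in fs -> derivable f) -> exists2 T, check T & {subset fs <= T}.
Proof.
elim: fs => [|f fs IH] h; first by exists [::].
have [|T cT sT] := IH; first by move=> g gfs; apply: h; rewrite in_cons gfs orbT.
have [|T' cT' fT'] := h f; first exact: mem_head.
exists (T' ++ T); last first.
  move=> g; rewrite in_cons mem_cat => /orP[/eqP->|/sT->]; rewrite ?fT' ?orbT //.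
elim: {fT'} T' cT' => //= g T' IHT; rewrite !check_cons => /andP[jg /IHT->].
by rewrite andbT; apply: just_mono jg => t; rewrite mem_cat => ->.
Qed.

Lemma derivable_just fs f :
  (forall g, g \in fs -> derivable g) -> just fs f -> derivable f.
Proof.
move=> /derivable_all[T cT sT] jf; exists (f :: T); last exact: mem_head.
by rewrite check_cons cT (just_mono sT).
Qed.

Lemma computes_derivable p xs y : computes p xs y -> derivable (code p, (xs, y)).
Proof.
elim/prog_ind': p xs y => [||i|p qs IHp IHqs|p q IHp IHq|p IHp] xs y /=.
- by move->; apply: (@derivable_just [::]); rewrite // /just /= pfst_pair.
- case: xs => // x xs ->; apply: (@derivable_just [::]) => //.
  by rewrite /just /= pfst_pair /=.
- move=> h; apply: (@derivable_just [::]) => //.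
  rewrite /just /= !(pfst_pair, psnd_pair) /=.
  by elim: i xs h => [|i IH] [|x xs] //=; [case=> -> /=|exact: IH].
- case=> ys /(pointwise_nth Zero 0)[sz hqs] hp.
  apply: (@derivable_just ((code p, (ys, y)) ::
    [seq (nth 0 [seq code q | q <- qs] j, (xs, nth 0 ys j)) | j <- iota 0 (size qs)])).
    move=> g; rewrite in_cons => /orP[/eqP->|/mapP[j]]; first exact: IHp.
    rewrite mem_iota add0n => lt ->; rewrite (nth_map Zero) //.
    by apply: IHqs => //; apply: hqs.
  rewrite /just /= !(pfst_pair, psnd_pair) /= encK !eqxx size_map sz eqxx.
  rewrite [X in X || _](_ : _ = true) //=.
  apply/allP => j lt; rewrite in_cons; apply/orP; right.
  by apply/mapP; exists j.
- case: xs => // n xs; elim: n y => [|m IHm] y.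
    move=> /IHp h; apply: (@derivable_just [:: (code p, (xs, y))]).
      by move=> g; rewrite inE => /eqP->.
    by rewrite /just /= !(pfst_pair, psnd_pair) /= inE eqxx.
  case=> r /IHm hr /IHq hq.
  apply: (@derivable_just [:: (code (PRec p q), (m :: xs, r));
                              (code q, ([:: m, r & xs], y))]).
    by move=> g; rewrite !inE => /orP[] /eqP->.
  by rewrite /just /= !(pfst_pair, psnd_pair) /= !inE !eqxx /= orbT.
- case=> /IHp h0 hi.
  have [T cT sT] : exists2 T, check T &
      forall i, i < y -> exists k, (code p, (i :: xs, k.+1)) \in T.
    elim: y {h0} hi => [|y IHy] hi; first by exists [::].
    have [|T cT sT] := IHy; first by move=> i lt; apply/hi/ltnW.
    have [k /IHp [T' cT' hT']] := hi y (ltnSn y).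
    have [|T'' cT'' sT''] := @derivable_all (T ++ [:: (code p, (y :: xs, k.+1))]).
      move=> f; rewrite mem_cat inE => /orP[fT|/eqP->]; first by exists T.
      by exists T'.
    exists T'' => // i; rewrite ltnS leq_eqVlt => /orP[/eqP->|/sT[k' h]].
      by exists k; apply: sT''; rewrite mem_cat mem_head orbT.
    by exists k'; apply: sT''; rewrite mem_cat h.
  apply: (@derivable_just ((code p, (y :: xs, 0)) :: T)).
    by move=> g; rewrite in_cons => /orP[/eqP-> //|gT]; exists T.
  rewrite /just /= !(pfst_pair, psnd_pair) /= mem_head /=; apply/allP => i.
  rewrite mem_iota => /sT[k kT]; apply/orP; right; apply/hasP.
  by exists (code p, (i :: xs, k.+1)) => //=; rewrite !eqxx.
Qed.

Lemma computes_fun p xs y y' : computes p xs y -> computes p xs y' -> y = y'.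
Proof.
elim/prog_ind': p xs y y' => [||i|p qs IHp IHqs|p q IHp IHq|p IHp] xs y y' /=.
- by move=> -> ->.
- by case: xs => // x xs -> ->.
- by move=> -> [].
- case=> ys /(pointwise_nth Zero 0)[sz hqs] hp.
  case=> ys' /(pointwise_nth Zero 0)[sz' hqs'] hp'.
  have e : ys = ys'.
    apply: (@eq_from_nth _ 0); first by rewrite -sz.
    by move=> j; rewrite -sz => lt; apply: IHqs (hqs j lt) (hqs' j lt).
  by apply: IHp hp _; rewrite e.
- case: xs => // n xs; elim: n y y' => [|m IHm] y y'; first exact: IHp.
  case=> r /IHm hr hq [r' /hr er]; rewrite -er; exact: IHq.
- case=> h0 hi [h0' hi'].
  case: (ltngtP y y') => // lt.
    by have [k /IHp/(_ h0)] := hi' _ lt.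
  by have [k /IHp/(_ h0')] := hi _ lt.
Qed.

(** Kleene's normal form: [t] is tried as the code of a derivation. The successor
of the value is returned, and 0 stands for failure. *)
Definition univ (e t x : nat) : nat :=
  let T : seq fact := dec t in
  if check T then head 0 [seq f.2.2.+1 | f <- T & (f.1 == e) && (f.2.1 == [:: x])]
  else 0.

Lemma cmp_univ : cmp (fun z : nat * nat * nat => univ z.1.1 z.1.2 z.2).
Proof.
rewrite /univ; cmp_auto; first apply: (cmp_comp cmp_check).
all: by apply: (cmp_comp cmp_dec); cmp_auto.
Qed.

Lemma univ_spec f : cnat f -> exists e,
  (forall t x, univ e t x = 0 \/ univ e t x = (f x).+1) /\
  (forall x, exists t, univ e t x = (f x).+1).
Proof.
case=> p hp; exists (code p).
have spec t x : univ (code p) t x = 0 \/ univ (code p) t x = (f x).+1.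
  rewrite /univ; case: ifP => [cT|]; last by left.
  case E : [seq _ | _ <- _ & _] => [|u s]; [by left | right; rewrite /=].
  have : u \in u :: s by rewrite mem_head.
  rewrite -E => /mapP[[c [xs y]]]; rewrite mem_filter.
  case/andP=> /andP[/eqP /= -> /eqP /= ->] /(check_sound cT) hy /= ->.
  by rewrite (computes_fun hy (hp x)).
split=> // x.
have [T cT hT] := computes_derivable (hp x); exists (enc T).
case: (spec (enc T) x) => //; rewrite /univ encK cT.
case E : [seq _ | _ <- _ & _] => [|u s].
  have : (f x).+1 \in ([::] : seq nat).
    rewrite -E; apply/mapP; exists (code p, ([:: x], f x)) => //.
    by rewrite mem_filter /= !eqxx.
  by [].
have : u \in u :: s by rewrite mem_head.
by rewrite -{1}E => /mapP[g _ ->].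
Qed.

(** * Finite partial isomorphisms and back-and-forth *)

Lemma prec_l A x y : prec A x y -> carrier A x.
Proof. by case/prec_carrier/andP. Qed.

Lemma prec_r A x y : prec A x y -> carrier A y.
Proof. by case/prec_carrier/andP. Qed.

Lemma prec_asym A x y : prec A x y -> prec A y x = false.
Proof.
by move=> xy; apply/negP => /(prec_trans xy); rewrite prec_irr.
Qed.

Lemma prec_cmp A x y : carrier A x -> carrier A y ->
  [\/ prec A x y, x = y | prec A y x].
Proof.
move=> hx hy; have [->|ne] := eqVneq x y; first by constructor 2.
by case/orP: (prec_total hx hy ne) => h; [constructor 1|constructor 3].
Qed.

(** A finite partial isomorphism, given by its graph. Functionality and
injectivity follow from the agreement of the strict orders, as these are
total. *)
Definition piso A B (h : seq (nat * nat)) : bool :=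
  all (fun u => carrier A u.1 && carrier B u.2 &&
                all (fun v => prec A u.1 v.1 == prec B u.2 v.2) h) h.

Lemma pisoP A B h : reflect
  (forall u, u \in h -> [/\ carrier A u.1, carrier B u.2 &
     forall v, v \in h -> prec A u.1 v.1 = prec B u.2 v.2]) (piso A B h).
Proof.
apply: (iffP allP) => H u /H; first by case/andP=> /andP[-> ->] /allP h'; split=> // v /h'/eqP.
by case=> -> -> h'; apply/allP => v /h' ->.
Qed.

Lemma piso_sub A B h h' : {subset h' <= h} -> piso A B h -> piso A B h'.
Proof.
move=> sub /pisoP H; apply/pisoP => u /sub/H[? ? h1]; split=> // v /sub; exact: h1.
Qed.

Lemma piso_inj A B h u v : piso A B h -> u \in h -> v \in h ->
  (u.1 = v.1 -> u.2 = v.2) /\ (u.2 = v.2 -> u.1 = v.1).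
Proof.
move=> /pisoP H uh vh; have [u1 u2 hu] := H u uh; have [v1 v2 hv] := H v vh.
split=> e.
  by case: (prec_cmp u2 v2) => // lt; [rewrite -hu // e in lt|rewrite -hv // e in lt];
    rewrite prec_irr in lt.
by case: (prec_cmp u1 v1) => // lt; [rewrite hu // e in lt|rewrite hv // e in lt];
    rewrite prec_irr in lt.
Qed.

Definition swap (h : seq (nat * nat)) := [seq (u.2, u.1) | u <- h].

Lemma mem_swap h x y : ((y, x) \in swap h) = ((x, y) \in h).
Proof.
by rewrite -[(y, x)]/((fun u => (u.2, u.1)) (x, y)) mem_map // => -[? ?] [? ?] [-> ->].
Qed.

Lemma piso_swap A B h : piso A B h -> piso B A (swap h).
Proof.
move/pisoP => H; apply/pisoP => -[y x]; rewrite mem_swap => /H[h1 h2 h3].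
by split=> // -[y' x']; rewrite mem_swap => /h3 /= ->.
Qed.

Lemma cmp_carrier C : computable_linorder C -> cmp (carrier C : nat -> bool).
Proof.
by case=> -[p hp] _; exists (fun x => nat_of_bool (carrier C x)) => //; exists p.
Qed.

Lemma cmp_prec C : computable_linorder C -> cmp (fun z : nat * nat => prec C z.1 z.2).
Proof.
case=> _ [p hp].
have [g hg eg] := @cmp_of_cnat2 (fun x y => prec C x y) (ex_intro _ p hp).
by exists g => // z; rewrite -eg.
Qed.

Lemma cmp_piso A B : computable_linorder A -> computable_linorder B ->
  cmp (piso A B).
Proof.
move=> hA hB; rewrite /piso; cmp_auto.
- by apply: (cmp_comp (cmp_carrier hA)); cmp_auto.
- by apply: (cmp_comp (cmp_carrier hB)); cmp_auto.
- by apply: (cmp_comp2 (cmp_prec hA)); cmp_auto.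
- by apply: (cmp_comp2 (cmp_prec hB)); cmp_auto.
Qed.

Section BackAndForth.
Variables (A B : linorder) (hA : computable_linorder A) (hB : computable_linorder B).
Variable h0 : seq (nat * nat).

Let valid h := piso A B h && all (fun u => u \in h) h0.

Hypothesis valid0 : valid h0.
Hypothesis forth : forall h x, valid h -> carrier A x ->
  exists y, piso A B ((x, y) :: h).
Hypothesis back : forall h y, valid h -> carrier B y ->
  exists x, piso A B ((x, y) :: h).

Lemma cmp_valid : cmp valid.
Proof. by rewrite /valid; cmp_auto; apply: cmp_piso. Qed.

(** The guards make both searches succeed for all lists and numbers. *)
Let forth_ok (z : seq (nat * nat) * nat) y :=
  (valid z.1 && carrier A z.2) ==> piso A B ((z.2, y) :: z.1).
Let back_ok (z : seq (nat * nat) * nat) x :=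
  (valid z.1 && carrier B z.2) ==> piso A B ((x, z.2) :: z.1).

Lemma ex_forth z : exists y, forth_ok z y.
Proof.
rewrite /forth_ok; case: (boolP (_ && _)) => [/andP[h c]|_]; last by exists 0.
exact: forth.
Qed.

Lemma ex_back z : exists x, back_ok z x.
Proof.
rewrite /back_ok; case: (boolP (_ && _)) => [/andP[h c]|_]; last by exists 0.
exact: back.
Qed.

Let addA h n := if carrier A n then (n, ex_minn (ex_forth (h, n))) :: h else h.
Let addB h n := if carrier B n then (ex_minn (ex_back (h, n)), n) :: h else h.

Lemma valid_sub h h' : {subset h <= h'} -> piso A B h' -> valid h -> valid h'.
Proof.
by rewrite /valid => sub -> /andP[_ /allP al]; apply/allP => u /al/sub.
Qed.

Lemma addAP h n : valid h -> [/\ valid (addA h n), {subset h <= addA h n} &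
  carrier A n -> exists y, (n, y) \in addA h n].
Proof.
move=> vh; rewrite /addA; case: ifP => cn; last by split.
have [y] := ex_minnP (ex_forth (h, n)); rewrite /forth_ok vh cn /= => ok _.
have sub : {subset h <= (n, y) :: h} by move=> u hu; rewrite in_cons hu orbT.
by split=> //; [exact: valid_sub vh|exists y; exact: mem_head].
Qed.

Lemma addBP h n : valid h -> [/\ valid (addB h n), {subset h <= addB h n} &
  carrier B n -> exists x, (x, n) \in addB h n].
Proof.
move=> vh; rewrite /addB; case: ifP => cn; last by split.
have [x] := ex_minnP (ex_back (h, n)); rewrite /back_ok vh cn /= => ok _.
have sub : {subset h <= (x, n) :: h} by move=> u hu; rewrite in_cons hu orbT.
by split=> //; [exact: valid_sub vh|exists x; exact: mem_head].
Qed.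

Lemma cmp_add2 : cmp (fun z : seq (nat * nat) * nat => addB (addA z.1 z.2) z.2).
Proof.
have cpiso := cmp_piso hA hB.
have cA : cmp (fun z : seq (nat * nat) * nat => addA z.1 z.2).
  rewrite /addA; cmp_auto; first by apply: (cmp_comp (cmp_carrier hA)); cmp_auto.
  apply: (cmp_comp (g := fun z => ex_minn (ex_forth z))); last by cmp_auto.
  apply: cmp_search; rewrite /forth_ok; cmp_auto.
  - by apply: (cmp_comp cmp_valid); cmp_auto.
  - by apply: (cmp_comp (cmp_carrier hA)); cmp_auto.
  - by apply: (cmp_comp cpiso); cmp_auto.
have cB : cmp (fun z : seq (nat * nat) * nat => addB z.1 z.2).
  rewrite /addB; cmp_auto; first by apply: (cmp_comp (cmp_carrier hB)); cmp_auto.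
  apply: (cmp_comp (g := fun z => ex_minn (ex_back z))); last by cmp_auto.
  apply: cmp_search; rewrite /back_ok; cmp_auto.
  - by apply: (cmp_comp cmp_valid); cmp_auto.
  - by apply: (cmp_comp (cmp_carrier hB)); cmp_auto.
  - by apply: (cmp_comp cpiso); cmp_auto.
by apply: (cmp_comp2 (h := addB)) => //; apply: cmp_proj2.
Qed.

Let hs n := foldl (fun h n => addB (addA h n) n) h0 (iota 0 n).
Let f (x : nat) := head 0 [seq u.2 | u <- hs x.+1 & u.1 == x].

Lemma hsS n : hs n.+1 = addB (addA (hs n) n) n.
Proof. by rewrite /hs -[n.+1]addn1 iotaD foldl_cat. Qed.

Lemma hs_valid n : valid (hs n).
Proof.
elim: n => // n /(addAP n)[vn _ _]; rewrite hsS.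
by case: (addBP n vn).
Qed.

Lemma hs_mono m n : m <= n -> {subset hs m <= hs n}.
Proof.
elim: n => [|n IH]; first by rewrite leqn0 => /eqP->.
rewrite leq_eqVlt => /orP[/eqP-> //|/IH sub] u /sub; rewrite hsS.
have [vA sA _] := addAP n (hs_valid n); have [_ sB _] := addBP n vA.
by move=> /sA/sB.
Qed.

Lemma hs_f x : carrier A x -> (x, f x) \in hs x.+1.
Proof.
move=> cx; have [vA sA /(_ cx)[y yA]] := addAP x (hs_valid x).
have [_ sB _] := addBP x vA; move/sB: yA; rewrite -hsS /f => hy.
have : y \in [seq u.2 | u <- hs x.+1 & u.1 == x].
  by apply/mapP; exists (x, y); rewrite // mem_filter eqxx.
case E : [seq _ | _ <- _ & _] => [|y' s] // _.
have : y' \in [seq u.2 | u <- hs x.+1 & u.1 == x] by rewrite E mem_head.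
by case/mapP=> -[x' z]; rewrite mem_filter /= => /andP[/eqP-> h] ->.
Qed.

Lemma hs_pair u n v m : u \in hs n -> v \in hs m ->
  exists2 h, piso A B h & u \in h /\ v \in h.
Proof.
move=> uh vh; exists (hs (maxn n m)); first by have /andP[] := hs_valid (maxn n m).
by split; apply: hs_mono; [exact: leq_maxl|exact: uh|exact: leq_maxr|exact: vh].
Qed.

(** Stage [n] puts [n] into the domain and into the range, so the union of the
stages is an isomorphism, and its value at [x] is known after stage [x]. *)
Lemma back_and_forth : exists f, [/\ lin_iso A B f, computable_on (carrier A) f &
  forall u, u \in h0 -> f u.1 = u.2].
Proof.
exists f; split.
- split.
  + by move=> x /hs_f fx; have /andP[/pisoP/(_ _ fx)[]] := hs_valid x.+1.
  + move=> x x' /hs_f fx /hs_f fx' e.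
    have [h ph [h1 h2]] := hs_pair fx fx'.
    exact: (piso_inj ph h1 h2).2.
  + move=> y cy; have [vA _ _] := addAP y (hs_valid y).
    have [_ _ /(_ cy)[x xy]] := addBP y vA; rewrite -hsS in xy.
    have /andP[/pisoP/(_ _ xy)[cx _ _] _] := hs_valid y.+1.
    exists x => //; have [h ph [h1 h2]] := hs_pair xy (hs_f cx).
    by rewrite [RHS](piso_inj ph h1 h2).1.
  + move=> x x' /hs_f fx /hs_f fx'.
    have [h /pisoP ph [h1 h2]] := hs_pair fx fx'.
    by have [_ _ /(_ _ h2)] := ph _ h1.
- have [p hp] : cnat f.
    apply/cmp_cnat; rewrite /f /hs; cmp_auto.
    apply: (cmp_foldl (g := fun _ h n => addB (addA h n) n)).
    + by apply: (cmp_comp2 (h := fun h n => addB (addA h n) n) cmp_add2); cmp_auto.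
    + by cmp_auto.
    + by cmp_auto.
  by exists p => x _; apply: hp.
- move=> [x y] uh /=; have /andP[/pisoP/(_ _ uh)[cx _ _] _] := valid0.
  have [h ph [h1 h2]] := @hs_pair (x, y) 0 _ _ uh (hs_f cx).
  by rewrite [RHS](piso_inj ph h1 h2).1.
Qed.

End BackAndForth.

(** * Two-sided limit points *)

Definition two_sided A x :=
  [/\ exists y, prec A y x, exists y, prec A x y,
      forall y, prec A y x -> exists2 z, prec A y z & prec A z x &
      forall y, prec A x y -> exists2 z, prec A x z & prec A z y].

(** Then each interval cut out by [F] is empty or dense without endpoints. *)
Definition almost_dense A := exists2 F : seq nat, {subset F <= carrier A} &
  forall x, carrier A x -> x \notin F -> two_sided A x.

Lemma exists_max A (s : seq nat) : {subset s <= carrier A} ->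
  s = [::] \/ exists2 m, m \in s & forall x, x \in s -> x = m \/ prec A x m.
Proof.
elim: s => [|x s IH] sub; [by left | right].
have cx : carrier A x by apply: sub; exact: mem_head.
have [|->|[m ms mM]] := IH; first by move=> y ys; apply: sub; rewrite in_cons ys orbT.
  by exists x; rewrite ?inE // => y; rewrite inE => /eqP; left.
have cm : carrier A m by apply: sub; rewrite in_cons ms orbT.
case: (prec_cmp cx cm) => h.
- exists m; rewrite ?in_cons ?ms ?orbT // => y; rewrite in_cons => /orP[/eqP->|/mM //].
  by right.
- exists m; rewrite ?in_cons ?ms ?orbT // => y; rewrite in_cons => /orP[/eqP->|/mM //].
  by left.
- exists x; rewrite ?mem_head // => y; rewrite in_cons => /orP[/eqP->|/mM[->|h']].
  + by left.
  + by right.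
  + by right; apply: prec_trans h' h.
Qed.

Definition dual (A : linorder) : linorder.
Proof.
apply: (@LinOrder (carrier A) (fun x y => prec A y x)).
- by move=> x y /prec_carrier; rewrite andbC.
- exact: prec_irr.
- by move=> y x z xy yz; apply: prec_trans yz xy.
- by move=> x y cx cy ne; rewrite orbC; apply: prec_total.
Defined.

(** Let [l] and [r] be the neighbours of [x] in the domain of [h]. If both are in
[F] then they are fixed and [x] can be mapped to itself; otherwise the image of
one of them is a two-sided limit, which leaves room between the images. *)
Lemma extend A (F : seq nat) h x :
  (forall x, carrier A x -> x \notin F -> two_sided A x) ->
  piso A A h -> (forall x, x \in F -> (x, x) \in h) -> carrier A x ->
  exists y, piso A A ((x, y) :: h).
Proof.
move=> hF ph hFh cx; have /pisoP H := ph.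
case: (boolP (has (fun u => u.1 == x) h)) => [/hasP[[x' y] uh /= /eqP e]|xh].
  subst x'; exists y; apply: piso_sub ph => u.
  by rewrite in_cons => /orP[/eqP->|].
have xne u : u \in h -> u.1 <> x.
  by move=> uh e; case/hasP: xh; exists u; rewrite ?e.
suff [y cy [hl hr]] : exists2 y, carrier A y &
    (forall u, u \in h -> prec A u.1 x -> prec A u.2 y) /\
    (forall u, u \in h -> prec A x u.1 -> prec A y u.2).
  exists y; apply/pisoP => u; rewrite in_cons => /orP[/eqP->|uh] /=.
    split=> // v; rewrite in_cons => /orP[/eqP->|vh] /=; first by rewrite !prec_irr.
    have [v1 v2 _] := H v vh.
    case: (prec_cmp cx v1) => [h1|/esym/(xne v vh) //|h1].
      by rewrite h1 hr.
    by rewrite (prec_asym h1) (prec_asym (hl _ vh h1)).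
  have [u1 u2 hu] := H u uh; split=> // v; rewrite in_cons => /orP[/eqP->|/hu //] /=.
  case: (prec_cmp cx u1) => [h1|/esym/(xne u uh) //|h1]; last by rewrite h1 hl.
  by rewrite (prec_asym h1) (prec_asym (hr _ uh h1)).
have subL P : {subset [seq u.2 | u <- h & P u] <= carrier A}.
  by move=> y /mapP[u]; rewrite mem_filter => /andP[_ /H[_ h2 _] ->].
have inF u : u \in h -> u.2 \in F -> u.1 = u.2.
  by move=> uh /hFh vh; have [_ ->] := piso_inj ph uh vh.
have getL (P : pred (nat * nat)) m : m \in [seq u.2 | u <- h & P u] ->
    exists2 u, u \in h & P u /\ m = u.2.
  by case/mapP=> u; rewrite mem_filter => /andP[? ?] ->; exists u.
set L := [seq u.2 | u <- h & prec A u.1 x]; set R := [seq u.2 | u <- h & prec A x u.1].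
suff [y cy [hl hr]] : exists2 y, carrier A y &
    (forall l, l \in L -> prec A l y) /\ (forall r, r \in R -> prec A y r).
  exists y => //; split=> u uh ux; [apply: hl|apply: hr];
    by apply/mapP; exists u; rewrite // mem_filter ux.
have LR l r : l \in L -> r \in R -> prec A l r.
  move=> /getL[u uh [ux ->]] /getL[v vh [xv ->]].
  have [_ _ /(_ v vh) <-] := H u uh; exact: prec_trans ux xv.
have LF l : l \in L -> l \in F -> prec A l x.
  by case/getL=> u uh [ux ->] /(inF u uh) <-.
have RF r : r \in R -> r \in F -> prec A x r.
  by case/getL=> u uh [ux ->] /(inF u uh) <-.
have cL l : l \in L -> carrier A l by apply: subL.
have cR r : r \in R -> carrier A r by apply: subL.
(* L and R are the images of the points below and above x. *)
move: L R LR LF RF cL cR => L R LR LF RF cL cR {subL getL inF xne}.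
have [L0|[l lL lM]] := exists_max (A := A) cL;
  have [R0|[r rR rM]] := exists_max (A := dual A) cR.
- by exists x => //; rewrite L0 R0.
- case: (boolP (r \in F)) => [rF|/(hF r (cR r rR))[[y yr] _ _ _]].
    exists x => //; rewrite L0; split=> // r' /rM[->|/= h1]; first exact: RF.
    exact: prec_trans (RF _ rR rF) h1.
  exists y; first exact: prec_l yr.
  by rewrite L0; split=> // r' /rM[->|/= h1] //; apply: prec_trans yr h1.
- case: (boolP (l \in F)) => [lF|/(hF l (cL l lL))[_ [y yl] _ _]].
    exists x => //; rewrite R0; split=> // l' /lM[->|/= h1]; first exact: LF.
    exact: prec_trans h1 (LF _ lL lF).
  exists y; first exact: prec_r yl.
  by rewrite R0; split=> // l' /lM[->|/= h1] //; apply: prec_trans h1 yl.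
- suff [y ly yr] : exists2 y, prec A l y & prec A y r.
    exists y; first exact: prec_r ly.
    split=> [l' /lM[->|h1]|r' /rM[->|/= h1]] //; first exact: prec_trans h1 ly.
    exact: prec_trans yr h1.
  have lr := LR _ _ lL rR.
  case: (boolP (l \in F)) => [lF|/(hF l (cL l lL))[_ _ _]]; last exact.
  case: (boolP (r \in F)) => [rF|/(hF r (cR r rR))[_ _ hr _]]; last exact: hr.
  by exists x; [exact: LF|exact: RF].
Qed.

(** Finite partial isomorphisms from [A] to [B] are composed with the inverse of
[f0], extended within [A], and carried back. *)
Lemma almost_dense_iso A B (F : seq nat) f0 h0 :
  computable_linorder A -> computable_linorder B ->
  (forall x, carrier A x -> x \notin F -> two_sided A x) ->
  lin_iso A B f0 -> {subset F <= carrier A} ->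
  piso A B h0 -> (forall x, x \in F -> (x, f0 x) \in h0) ->
  exists f, [/\ lin_iso A B f, computable_on (carrier A) f &
    forall u, u \in h0 -> f u.1 = u.2].
Proof.
move=> hA hB hF [f1 f2 f3 f4] FA p0 h0F.
have pull h : piso A B h -> all (fun u => u \in h) h0 -> exists h',
    [/\ h = [seq (u.1, f0 u.2) | u <- h'], piso A A h' &
      forall x, x \in F -> (x, x) \in h'].
  move=> /pisoP H /allP sub.
  have [h' eh ch'] : exists2 h', h = [seq (u.1, f0 u.2) | u <- h'] &
      forall u, u \in h' -> carrier A u.2.
    have cB u : u \in h -> carrier B u.2 by case/H.
    elim: h cB {H sub} => [|[x y] h IH] cB; first by exists [::].
    have [|h' -> ch'] := IH; first by move=> u uh; apply: cB; rewrite in_cons uh orbT.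
    have [y' cy' <-] := f3 y (cB _ (mem_head _ _)).
    by exists ((x, y') :: h') => // u; rewrite in_cons => /orP[/eqP->|/ch'].
  have H' u : u \in h' -> (u.1, f0 u.2) \in h by move=> uh; rewrite eh; apply: map_f.
  exists h'; split=> //.
    apply/pisoP => u uh; have [u1 _ hu] := H _ (H' u uh); split=> //; first exact: ch'.
    move=> v vh; rewrite (hu _ (H' v vh)) /= f4 //; exact: ch'.
  move=> x xF; move/sub: (h0F x xF); rewrite eh => /mapP[[x1 x2] uh [e1 e2]].
  by rewrite {1}e1 (f2 _ _ (FA _ xF) (ch' _ uh) e2).
have push h : piso A A h -> piso A B [seq (u.1, f0 u.2) | u <- h].
  move=> /pisoP H; apply/pisoP => u /mapP[u' /H[u1 u2 hu] ->]; split=> //; first exact: f1.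
  move=> v /mapP[v' vh ->] /=; rewrite f4 //; first exact: hu.
  by case: (H v' vh).
have v0 : piso A B h0 && all (fun u => u \in h0) h0 by rewrite p0; apply/allP.
apply: (back_and_forth hA hB v0).
  move=> h x /andP[ph sub] cx; have [h' [eh ph' hF']] := pull h ph sub.
  have [y] := extend hF ph' hF' cx => /push py.
  by exists (f0 y); rewrite eh.
move=> h y /andP[ph sub] cy; have [h' [eh ph' hF']] := pull h ph sub.
have [y' cy' ey] := f3 y cy.
have [|x px] := @extend A F (swap h') y' hF (piso_swap ph') _ cy'.
  by move=> z zF; rewrite mem_swap; apply: hF'.
exists x; rewrite eh -ey; apply: (push ((x, y') :: h')).
by have := piso_swap px; rewrite /swap /= -map_comp map_id_in // => -[].
Qed.

(** * Almost dense orders *)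

Lemma piso_graph A B (s : seq nat) f : {subset s <= carrier A} ->
  (forall x, x \in s -> carrier B (f x)) ->
  {in s &, forall x y, prec B (f x) (f y) = prec A x y} ->
  piso A B [seq (x, f x) | x <- s].
Proof.
move=> sA sB fs; apply/pisoP => _ /mapP[x xs ->]; split; [exact: sA|exact: sB|].
by move=> _ /mapP[y ys ->] /=; rewrite fs.
Qed.

Lemma almost_dense_cc A : computable_linorder A -> almost_dense A ->
  computably_categorical A.
Proof.
move=> hA [F FA hF] B hB [f0 isof]; have [f1 f2 f3 f4] := isof.
have p0 : piso A B [seq (x, f0 x) | x <- F].
  apply: piso_graph => //; first by move=> x /FA; apply: f1.
  by move=> x y /FA cx /FA cy; apply: f4.
have [|f [isof' cf _]] := almost_dense_iso hA hB hF isof FA p0.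
  by move=> x xF; apply: map_f.
by exists f.
Qed.

Lemma almost_dense_wuh A : computable_linorder A -> almost_dense A ->
  weakly_ultrahomogeneous A.
Proof.
move=> hA [F FA hF]; exists F => // S T f SA TA FS _ [f1 _ _ f4] fF.
have iso_id : lin_iso A A id by split=> // y cy; exists y.
have p0 : piso A A [seq (x, f x) | x <- S].
  by apply: piso_graph => // x /f1 /TA.
have [|g [isog _ gf]] := almost_dense_iso hA hA hF iso_id FA p0.
  by move=> x xF; apply/mapP; exists x; [exact: FS|rewrite fF].
by exists g => // x xS; apply: (gf (x, f x)); apply: map_f.
Qed.

Definition fin (P : nat -> Prop) := exists s : seq nat, forall x, P x -> x \in s.

Lemma fin_sub (P Q : nat -> Prop) : (forall x, P x -> Q x) -> fin Q -> fin P.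
Proof. by move=> PQ [s hs]; exists s => x /PQ/hs. Qed.

Lemma fin_or (P Q : nat -> Prop) : fin P -> fin Q -> fin (fun x => P x \/ Q x).
Proof.
move=> [s hs] [t ht]; exists (s ++ t) => x.
by rewrite mem_cat => -[/hs->|/ht->]; rewrite ?orbT.
Qed.

Lemma fin_unique (P : nat -> Prop) : (forall x y, P x -> P y -> x = y) -> fin P.
Proof.
move=> uP; case: (classic (exists x, P x)) => [[x Px]|nP].
  by exists [:: x] => y Py; rewrite inE (uP y x).
by exists [::] => x Px; case: nP; exists x.
Qed.

Lemma fin_ex (I : eqType) (r : seq I) (P : I -> nat -> Prop) :
  (forall i, fin (P i)) -> fin (fun x => exists2 i, i \in r & P i x).
Proof.
move=> hP; elim: r => [|i r IH]; first by exists [::] => x [].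
apply: fin_sub (fin_or (hP i) IH) => x [j].
by rewrite in_cons => /orP[/eqP->|jr] Px; [left|right; exists j].
Qed.

(** Partial isomorphisms that move points only within the cuts of [a] extend to
automorphisms fixing [a], so the points of one cut are alike. *)
Section Homogeneous.
Variables (A : linorder) (a : seq nat).
Hypothesis aA : {subset a <= carrier A}.
Hypothesis ext : forall (S T : seq nat) (f : nat -> nat),
  {subset S <= carrier A} -> {subset T <= carrier A} ->
  {subset a <= S} -> {subset a <= T} ->
  isomorphism (mem S) (prec A) (mem T) (prec A) f ->
  {in a, forall x, f x = x} -> exists2 g, automorphism A g & {in S, g =1 f}.

Definition moves (h : seq (nat * nat)) := exists g : nat -> nat,
  [/\ forall x y, carrier A x -> carrier A y -> prec A (g x) (g y) = prec A x y,
      forall x, carrier A x -> carrier A (g x) /\ (x \in a -> g x = x),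
      forall y, carrier A y -> exists2 x, carrier A x & g x = y &
      forall u, u \in h -> g u.1 = u.2].

Lemma piso_extends h : piso A A h -> (forall x, x \in a -> (x, x) \in h) -> moves h.
Proof.
move=> ph ah; have /pisoP H := ph.
pose f x := head 0 [seq u.2 | u <- h & u.1 == x].
have fE u : u \in h -> f u.1 = u.2.
  move=> uh; rewrite /f.
  have : u.2 \in [seq v.2 | v <- h & v.1 == u.1].
    by apply/mapP; exists u; rewrite // mem_filter eqxx.
  case E : [seq _ | _ <- _ & _] => [|y s] // _.
  have : y \in [seq v.2 | v <- h & v.1 == u.1] by rewrite E mem_head.
  case/mapP=> v; rewrite mem_filter => /andP[/eqP e vh] -> /=.
  exact: (piso_inj ph vh uh).1.
have [g [g1 _ g3 g4] gf] : exists2 g, automorphism A g &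
    {in [seq u.1 | u <- h], g =1 f}.
  apply: (@ext _ [seq u.2 | u <- h]).
  - by move=> _ /mapP[u /H[? _ _] ->].
  - by move=> _ /mapP[u /H[_ ? _] ->].
  - by move=> x /ah xh; apply/mapP; exists (x, x).
  - by move=> x /ah xh; apply/mapP; exists (x, x).
  - split=> /=.
    + by move=> _ /mapP[u uh ->]; rewrite fE // map_f.
    + move=> _ _ /mapP[u uh ->] /mapP[v vh ->]; rewrite !fE //.
      exact: (piso_inj ph uh vh).2.
    + by move=> _ /mapP[u uh ->]; exists u.1; [exact: map_f|exact: fE].
    + move=> _ _ /mapP[u uh ->] /mapP[v vh ->]; rewrite !fE //.
      by case: (H u uh) => _ _ ->.
  - by move=> x /ah /fE.
have gE u : u \in h -> g u.1 = u.2 by move=> uh; rewrite gf ?fE // map_f.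
by exists g; split=> // x cx; split=> [|/ah/gE //]; apply: g1.
Qed.

Definition cut x := [seq prec A c x | c <- a].

Definition same_cut x y := [/\ carrier A x, carrier A y, x \notin a, y \notin a &
  cut x = cut y].

Lemma same_cutP x y c : same_cut x y -> c \in a ->
  prec A c x = prec A c y /\ prec A x c = prec A y c.
Proof.
case=> cx cy xa ya /eq_in_map e ca; have cc := aA ca.
have xc : x <> c by move=> E; rewrite E ca in xa.
have yc : y <> c by move=> E; rewrite E ca in ya.
have E := e c ca; split=> //.
case: (prec_cmp cc cx) => [h|/esym //|h].
  by rewrite (prec_asym h) (prec_asym (y := y)) // -E.
case: (prec_cmp cc cy) => [h'|/esym //|h']; last by rewrite h h'.
by rewrite -E (prec_asym h) in h'.
Qed.

Lemma same_cut_between x y z : same_cut x y -> prec A x z -> prec A z y -> same_cut x z.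
Proof.
move=> sc xz zy; have [cx cy xa ya e] := sc; split=> //.
- exact: prec_r xz.
- apply/negP => za; have [_ h] := same_cutP sc za.
  by rewrite xz (prec_asym zy) in h.
- apply/eq_in_map => c ca; have [h _] := same_cutP sc ca.
  case: (boolP (prec A c x)) => cx'; first by rewrite (prec_trans cx' xz).
  apply/esym/negP => cz; move: cx'; rewrite h => /negP; apply.
  exact: prec_trans cz zy.
Qed.

Lemma same_cut_sym x y : same_cut x y -> same_cut y x.
Proof. by case. Qed.

Lemma same_cut_trans x y z : same_cut x y -> same_cut y z -> same_cut x z.
Proof. by case=> cx _ xa _ e [_ cz _ za e2]; split=> //; rewrite e. Qed.

Lemma moves_cut h : (forall u, u \in h -> same_cut u.1 u.2) -> piso A A h -> moves h.
Proof.
move=> hc ph; have /pisoP H := ph.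
have [||g [g1 g2 g3 g4]] := @piso_extends (h ++ [seq (x, x) | x <- a]).
- apply/pisoP => u; rewrite mem_cat => /orP[uh|/mapP[x xa ->]].
    have [u1 u2 hu] := H u uh; split=> // v.
    rewrite mem_cat => /orP[/hu //|/mapP[c ca ->]] /=.
    by have [_ ->] := same_cutP (hc u uh) ca.
  split; [exact: aA|exact: aA|] => v.
  rewrite mem_cat => /orP[vh|/mapP[c ca ->]] //=.
  by have [-> _] := same_cutP (hc v vh) xa.
- by move=> x xa; rewrite mem_cat; apply/orP; right; apply/mapP; exists x.
by exists g; split=> // u uh; apply: g4; rewrite mem_cat uh.
Qed.

Lemma moves1 x y : same_cut x y -> moves [:: (x, y)].
Proof.
move=> sc; apply: moves_cut => [u|]; first by rewrite inE => /eqP->.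
apply/pisoP => u; rewrite inE => /eqP-> /=; case: sc => cx cy _ _ _.
by split=> // v; rewrite inE => /eqP-> /=; rewrite !prec_irr.
Qed.

Lemma moves2 x x' y y' : same_cut x x' -> same_cut y y' ->
  prec A x y -> prec A x' y' -> moves [:: (x, x'); (y, y')].
Proof.
move=> sx sy xy xy'; apply: moves_cut => [u|].
  by rewrite !inE => /orP[]/eqP->.
case: sx => cx cx' _ _ _; case: sy => cy cy' _ _ _.
apply/pisoP => u; rewrite !inE => /orP[]/eqP-> /=; split=> // v;
  by rewrite !inE => /orP[]/eqP-> /=; rewrite ?prec_irr ?xy ?xy' ?(prec_asym xy) ?(prec_asym xy').
Qed.

Lemma moves_same_cut g y :
  (forall x y, carrier A x -> carrier A y -> prec A (g x) (g y) = prec A x y) ->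
  (forall x, carrier A x -> carrier A (g x) /\ (x \in a -> g x = x)) ->
  carrier A y -> y \notin a -> same_cut y (g y).
Proof.
move=> g1 g2 cy ya; split=> //; first by case: (g2 y cy).
  apply/negP => ga; have cg := aA ga; have [_ /(_ ga) gg] := g2 _ cg.
  by case: (prec_cmp cy cg) => h; [|by rewrite -h (negPf ya) in ga|];
    rewrite -g1 // gg prec_irr in h.
apply/eq_in_map => c ca; have cc := aA ca; have [_ /(_ ca) gc] := g2 c cc.
by rewrite -{2}gc g1.
Qed.

(** An automorphism taking [x2] to [x] pushes [x] to its other side. *)
Lemma cut_unbounded x x2 : same_cut x x2 -> x2 <> x ->
  (exists2 w, prec A w x & same_cut w x) /\ (exists2 w, prec A x w & same_cut x w).
Proof.
move=> sc ne; have [cx cx2 xa x2a _] := sc.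
have [g [g1 g2 _ /(_ _ (mem_head _ _)) /= gE]] := moves1 (same_cut_sym sc).
have sg := moves_same_cut g1 g2 cx xa.
case: (prec_cmp cx cx2) => [lt|/esym //|lt]; split.
- by exists (g x); [rewrite -{2}gE g1|apply: same_cut_sym].
- by exists x2.
- by exists x2 => //; apply: same_cut_sym.
- by exists (g x); [rewrite -{1}gE g1|].
Qed.

(** Given [y] below [x] in its cut, pick [w2] above [x] in the same cut. Some
automorphism fixes [y] and takes [x] to [w2]; the point that it takes to [x]
lies between [y] and [x]. *)
Lemma cut_two_sided x x2 : same_cut x x2 -> x2 <> x -> two_sided A x.
Proof.
move=> sc ne; have [[w wx sw] [w2 xw sw2]] := cut_unbounded sc ne.
have refl y : same_cut y x -> same_cut y y by case.
split; [by exists w|by exists w2| |] => y h.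
- have [yw|sy] : prec A y w \/ same_cut y x.
    case: (prec_cmp (prec_l h) (prec_l wx)) => [|->|wy]; [by left|by right|right].
    exact: same_cut_trans (same_cut_sym (same_cut_between sw wy h)) sw.
    by exists w.
  have [g [g1 _ g3 gE]] := moves2 (refl y sy) sw2 h (prec_trans h xw).
  have gy := gE _ (mem_head _ _); have gx : g x = w2.
    by apply: (gE (x, w2)); rewrite !inE eqxx orbT.
  have [z cz gz] := g3 x (prec_r h); exists z.
    by rewrite -g1 ?gz ?[g y]gy // (prec_l h).
  by rewrite -g1 ?gz ?gx // (prec_r h).
- have [yw|sy] : prec A w2 y \/ same_cut y x.
    case: (prec_cmp (prec_r h) (prec_r xw)) => [yw|->|]; [right|right|by left].
      exact: same_cut_sym (same_cut_between sw2 h yw).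
    exact: same_cut_sym.
    by exists w2.
  have [g [g1 _ g3 gE]] := moves2 (same_cut_sym sw) (refl y sy) h (prec_trans wx h).
  have gx := gE _ (mem_head _ _); have gy : g y = y.
    by apply: (gE (y, y)); rewrite !inE eqxx orbT.
  have [z cz gz] := g3 x (prec_l h); exists z.
    by rewrite -g1 ?gz ?[g x]gx // (prec_l h).
  by rewrite -g1 ?gz ?gy // (prec_r h).
Qed.

(** The exceptional points are the parameters and the points that are alone in
their cuts; there are finitely many cuts. *)
Lemma homogeneous_almost_dense : almost_dense A.
Proof.
pose alone x := [/\ carrier A x, x \notin a & forall y, same_cut x y -> y = x].
have [s hs] : fin alone.
  apply: (fin_sub _ (@fin_ex _ (enum {: (size a).-tuple bool})
                            (fun t x => alone x /\ cut x = t) _)).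
    move=> x ax; have sz : size (cut x) == size a by rewrite size_map.
    by exists (Tuple sz); rewrite ?mem_enum.
  move=> t; apply: fin_unique => x y [[cx xa ux] ex] [[cy ya _] ey].
  by apply/esym/ux; split=> //; rewrite ex.
exists ([seq x <- s | carrier A x] ++ a).
  by move=> x; rewrite mem_cat mem_filter => /orP[/andP[]|/aA].
move=> x cx; rewrite mem_cat mem_filter cx /= => /norP[xs xa].
case: (classic (exists y, same_cut x y /\ y <> x)) => [[y [sc ne]]|nex].
  exact: cut_two_sided sc ne.
case/negP: xs; apply: hs; split=> // y sc.
by apply: NNPP => ne; case: nex; exists y.
Qed.

End Homogeneous.

Lemma wuh_almost_dense A : weakly_ultrahomogeneous A -> almost_dense A.
Proof. by case=> a aA; apply: homogeneous_almost_dense. Qed.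

(** * Inserting into two parallel lists *)

Definition ins (p x : nat) (L : seq nat) := take p L ++ x :: drop p L.

Lemma perm_ins p x L : perm_eq (ins p x L) (x :: L).
Proof. by rewrite /ins perm_catC /= perm_cons perm_catC cat_take_drop. Qed.

Lemma index_ins_old p x y L : y \in L -> y != x ->
  index y (ins p x L) = index y L + (p <= index y L).
Proof.
move=> yL yx; rewrite /ins index_cat -[in RHS](cat_take_drop p L) index_cat.
have [yt|yt] := boolP (y \in take p L).
  have := yt; rewrite -index_mem size_take_min => h.
  by rewrite leqNgt (leq_trans h) ?geq_minl ?addn0.
rewrite /= eq_sym (negPf yx) size_take_min.
suff le : p <= size L by rewrite (minn_idPl le) leq_addr addn1 addnS.
rewrite leqNgt; apply/negP => /ltnW le.
by rewrite take_oversize ?yL in yt.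
Qed.

Lemma index_ins_new p x L : x \notin L -> p <= size L -> index x (ins p x L) = p.
Proof.
move=> xL le; rewrite /ins index_cat ifN ?size_take_min ?(minn_idPl le) /= ?eqxx ?addn0 //.
by apply: contra xL => /mem_take.
Qed.

Lemma count_downset (P : pred nat) L : pairwise (fun a b => P b ==> P a) L ->
  all P (take (count P L) L) && all (predC P) (drop (count P L) L).
Proof.
elim: L => //= a L IH /andP[/allP h /IH {}IH].
have [Pa|nPa] := boolP (P a); first by rewrite /= Pa.
have e : count P L = 0.
  by apply/eqP; rewrite -leqn0 leqNgt -has_count; apply/hasP => -[b /h/implyP hb /hb]; apply/negP.
by move: IH; rewrite e take0 drop0 /= nPa.
Qed.

(** The entries between positions [p] and [q], whichever comes first: the truncated
differences vanish on one side, and [p - (p - q)] is the minimum. *)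
Definition seg T (p q : nat) (Z : seq T) :=
  take ((p - q) + (q - p)) (drop (p - (p - q)) Z).

Lemma seg_count T (P : pred T) p q (Z : seq T) :
  count P (take p Z) = count P (take q Z) -> ~~ has P (seg p q Z).
Proof.
rewrite has_count -leqNgt leqn0 /seg; wlog le : p q / p <= q => [hw|].
  have [/hw //|/ltnW le e] := leqP p q.
  by have := hw q p le (esym e); rewrite addnC -!minnE minnC.
have -> : p - q = 0 by lia.
rewrite subn0 add0n -{1}(subnKC le) takeD count_cat => /eqP.
by rewrite -{1}[count _ (take p Z)]addn0 eqn_add2l eq_sym.
Qed.

Section Protected.
Variable c : pred nat.
Let prot (u : nat * nat) := c u.1 || c u.2.

Lemma has_prot_zip s t : size s = size t ->
  has prot (zip s t) = has c s || has c t.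
Proof.
elim: s t => [|x s IH] [|y t] //= [/IH->]; rewrite /prot /=.
by case: (c x); case: (c y); case: (has c s).
Qed.

Lemma filter_prot_zip s t : ~~ has c s -> ~~ has c t -> filter prot (zip s t) = [::].
Proof.
elim: s t => [|x s IH] [|y t] //=; rewrite !negb_or => /andP[cx hs] /andP[cy ht].
by rewrite /prot /= (negPf cx) (negPf cy) /=; apply: IH.
Qed.

Lemma cut3 T p q (L : seq T) : p <= q -> q <= size L -> exists s1 s2 s3,
  [/\ L = s1 ++ s2 ++ s3, size s1 = p & size s2 = q - p].
Proof.
move=> pq qL; exists (take p L), (take (q - p) (drop p L)), (drop q L).
rewrite -{2}(subnK pq) -drop_drop !cat_take_drop !size_takel ?size_drop ?leq_sub2r //.
exact: leq_trans pq qL.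
Qed.

Lemma ins_cat x s t : ins (size s) x (s ++ t) = s ++ x :: t.
Proof. by rewrite /ins take_size_cat // drop_size_cat. Qed.

(** Insertion at different places [p] and [q] of two parallel lists re-pairs only
the entries in between. If none of these is protected, the protected pairs
survive, and [x] has the same number of them before it in both lists. *)
Lemma ins_zip p q x LA LB : size LA = size LB -> p <= size LA -> q <= size LA ->
  c x = false -> ~~ has prot (seg p q (zip LA LB)) ->
  filter prot (zip (ins p x LA) (ins q x LB)) = filter prot (zip LA LB) /\
  count prot (take q.+1 (zip (ins p x LA) (ins q x LB))) =
  count prot (take p (zip LA LB)).
Proof.
move=> sz lp lq cx.
have [le|/ltnW le] := leqP p q.
- have [X1 [X2 [X3 [eA sX1 sX2]]]] := cut3 le lq.
  rewrite sz in lq; have [Y1 [Y2 [Y3 [eB sY1 sY2]]]] := cut3 le lq.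
  have s1 : size X1 = size Y1 by rewrite sX1.
  have s2 : size X2 = size Y2 by rewrite sX2.
  have eq : q = size (Y1 ++ Y2) by rewrite size_cat sY1 sY2 subnKC.
  rewrite /seg (_ : p - q = 0) ?subn0 ?add0n; last by lia.
  have -> : ins p x LA = X1 ++ (x :: X2) ++ X3 by rewrite eA -sX1 ins_cat.
  have -> : ins q x LB = Y1 ++ rcons Y2 x ++ Y3.
    by rewrite eB eq catA ins_cat -catA cat_rcons.
  rewrite eA eB.
  have s2' : size (x :: X2) = size (rcons Y2 x) by rewrite size_rcons /= s2.
  rewrite !(zip_cat _ _ s1) !(zip_cat _ _ s2) !(zip_cat _ _ s2').
  have z1 : size (zip X1 Y1) = p by rewrite size_zip -s1 minnn.
  have z2 : size (zip X2 Y2) = q - p by rewrite size_zip -s2 minnn.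
  rewrite (drop_size_cat _ z1) (take_size_cat _ z2) (take_size_cat _ z1).
  rewrite has_prot_zip // negb_or => /andP[h1 h2].
  have n2 : filter prot (zip (x :: X2) (rcons Y2 x)) = [::].
    by apply: filter_prot_zip; rewrite /= ?has_rcons cx.
  rewrite !filter_cat n2 (filter_prot_zip h1 h2); split=> //.
  rewrite catA take_size_cat; first by rewrite count_cat -(size_filter _ (zip (_ :: _) _)) n2 addn0.
  by rewrite size_cat z1 size_zip -s2' minnn /= sX2 addnS subnKC.
- have [X1 [X2 [X3 [eA sX1 sX2]]]] := cut3 le lp.
  rewrite sz in lp; have [Y1 [Y2 [Y3 [eB sY1 sY2]]]] := cut3 le lp.
  have s1 : size X1 = size Y1 by rewrite sX1.
  have s2 : size X2 = size Y2 by rewrite sX2.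
  have ep : p = size (X1 ++ X2) by rewrite size_cat sX1 sX2 subnKC.
  rewrite /seg (_ : q - p = 0) ?subKn ?addn0 //; last by lia.
  have -> : ins q x LB = Y1 ++ (x :: Y2) ++ Y3 by rewrite eB -sY1 ins_cat.
  have -> : ins p x LA = X1 ++ rcons X2 x ++ X3.
    by rewrite eA ep catA ins_cat -catA cat_rcons.
  rewrite eA eB.
  have s2' : size (rcons X2 x) = size (x :: Y2) by rewrite size_rcons /= s2.
  rewrite !(zip_cat _ _ s1) !(zip_cat _ _ s2) !(zip_cat _ _ s2').
  have z1 : size (zip X1 Y1) = q by rewrite size_zip -s1 minnn.
  have z2 : size (zip X2 Y2) = p - q by rewrite size_zip -s2 minnn.
  rewrite (drop_size_cat _ z1) (take_size_cat _ z2).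
  rewrite has_prot_zip // negb_or => /andP[h1 h2].
  have hx1 : ~~ has c (rcons X2 x) by rewrite has_rcons cx.
  have hx2 : ~~ has c (x :: Y2) by rewrite /= cx.
  have n2 := filter_prot_zip hx1 hx2.
  rewrite !filter_cat n2 (filter_prot_zip h1 h2); split=> //.
  have -> : take p (zip X1 Y1 ++ zip X2 Y2 ++ zip X3 Y3) = zip X1 Y1 ++ zip X2 Y2.
    by rewrite catA take_size_cat // size_cat z1 z2 subnKC.
  rewrite !count_cat -(size_filter _ (zip X2 Y2)) (filter_prot_zip h1 h2) addn0.
  rewrite -[q.+1]addn1 takeD -{1}z1 take_size_cat // drop_size_cat // count_cat.
  suff -> : count prot (take 1 (zip (rcons X2 x) (x :: Y2) ++ zip X3 Y3)) = 0.
    by rewrite addn0.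
  case: X2 s2 sX2 s2' z2 h1 hx1 n2 ep {eA eB} => [|x2 X2] //= _ _ _ _ h1 _ _ _.
    by rewrite take0 /prot /= cx.
  by move: h1; rewrite negb_or take0 /= /prot /= cx => /andP[/negPf-> _].
Qed.

End Protected.

(** * Diagonalization against computable isomorphisms *)

(** The approximation at stage [s]; as for [univ], 0 means that there is no value
yet. Taking the first success makes it stable even for codes of no program. *)
Definition phi (e x s : nat) : nat :=
  head 0 [seq u <- [seq univ e t x | t <- iota 0 s] | 0 < u].

Definition Phi e x y := exists s, phi e x s = y.+1.

Lemma phi_stable e x s s' : s <= s' -> 0 < phi e x s -> phi e x s' = phi e x s.
Proof.
move=> le; rewrite /phi -(subnKC le) iotaD map_cat filter_cat.
by case: [seq u <- [seq univ e t x | t <- iota 0 s] | _].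
Qed.

Lemma Phi_fun e x y y' : Phi e x y -> Phi e x y' -> y = y'.
Proof.
move=> [s hs] [s' hs']; wlog le : y y' s s' hs hs' / s <= s' => [hw|].
  by case: (leqP s s') => [|/ltnW] /hw h; [|apply/esym]; apply: h; eassumption.
by move: hs'; rewrite (phi_stable le) ?hs // => -[].
Qed.

Lemma Phi_phi e x y s : Phi e x y -> 0 < phi e x s -> phi e x s = y.+1.
Proof.
move=> h rank; have : Phi e x (phi e x s).-1 by exists s; rewrite prednK.
by move/(Phi_fun h) => ->; rewrite prednK.
Qed.

Lemma Phi_limit e x y : Phi e x y -> exists s0, forall s, s0 <= s -> phi e x s = y.+1.
Proof. by move=> [s0 h]; exists s0 => s /(phi_stable (e := e) (x := x)) ->; rewrite h. Qed.

Lemma Phi_univ f : cnat f -> exists e, forall x, Phi e x (f x).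
Proof.
case/univ_spec=> e [h1 h2]; exists e => x; have [t ht] := h2 x.
exists t.+1; rewrite /phi.
have : (f x).+1 \in [seq u <- [seq univ e t x | t <- iota 0 t.+1] | 0 < u].
  rewrite mem_filter; apply/andP; split=> //; apply/mapP.
  by exists t; rewrite ?ht ?mem_iota ?add0n ?ltnSn.
case E : [seq _ <- _ | _] => [|v s] // _; rewrite [head _ _]/=.
have : v \in v :: s by rewrite mem_head.
rewrite -E mem_filter => /andP[v0 /mapP[t' _ ev]].
by case: (h1 t' x) => e'; rewrite ev e' // in v0 *.
Qed.

Lemma cmp_phi : cmp (fun z : nat * nat * nat => phi z.1.1 z.1.2 z.2).
Proof.
rewrite /phi; cmp_auto.
by apply: (cmp_comp (g := fun z : nat * nat * nat => univ z.1.1 z.1.2 z.2) cmp_univ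
    (f := fun z : nat * nat * nat * nat => (z.1.1.1, z.2, z.1.1.2))); cmp_auto.
Qed.

Definition next_in (L : seq nat) x y := index y L == (index x L).+1.

Lemma next_in_ins p s L x y : x \in L -> y \in L -> s \notin L ->
  next_in (ins p s L) x y -> next_in L x y.
Proof.
move=> xL yL sL; have ne z : z \in L -> z != s by apply: contraL => /eqP->.
rewrite /next_in !index_ins_old ?ne // => /eqP h; apply/eqP.
by move: h; case: leqP; case: leqP => /=; lia.
Qed.

Definition least_below (P : pred nat) s := head 0 [seq i <- iota 0 s | P i].

Lemma least_belowP (P : pred nat) s k : k < s -> P k ->
  P (least_below P s) /\ least_below P s <= k.
Proof.
move=> lt Pk; rewrite /least_below -(subnKC (ltnW lt)) iotaD filter_cat add0n.
case E : [seq i <- iota 0 k | P i] => [|j t] /=.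
  by rewrite -[s - k]prednK ?subn_gt0 //= Pk.
have : j \in [seq i <- iota 0 k | P i] by rewrite E mem_head.
by rewrite mem_filter mem_iota => /and3P[Pj _ /ltnW].
Qed.

Lemma count_take_zip (P : pred (nat * nat)) k s t : size s = size t -> uniq t ->
  count P (take k (zip s t)) = count (fun u => P u && (index u.2 t < k)) (zip s t).
Proof.
elim: k s t => [|k IH] s t sz ut.
  by rewrite take0; apply/esym/eqP; rewrite -leqn0 leqNgt -has_count; apply/hasP => -[u _]; rewrite andbF.
case: s t sz ut => [|x s] [|y t] // [sz] /= /andP[yt ut].
rewrite eqxx andbT IH //; congr (_ + _).
apply: eq_in_count => -[a b] /= /(map_f snd) /=.
rewrite -/(unzip2 _) unzip2_zip ?sz // => bt; case: eqP => // e.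
by rewrite e bt in yt.
Qed.

Lemma pfst_le i : pfst i <= i. Proof. by rewrite -{2}[i]pair_fst_snd leq_pair1. Qed.
Lemma psnd_le i : psnd i <= i. Proof. by rewrite -{2}[i]pair_fst_snd leq_pair2. Qed.

Lemma eventually_bound (Q : nat -> nat -> Prop) N :
  (forall t, t < N -> exists s0, forall s, s0 <= s -> Q t s) ->
  exists s0, forall s t, s0 <= s -> t < N -> Q t s.
Proof.
elim: N => [|N IH] h; first by exists 0.
have [|s0 h0] := IH; first by move=> t /ltnW/h.
have [s1 h1] := h N (ltnSn N); exists (maxn s0 s1) => s t.
rewrite geq_max => /andP[le0 le1]; rewrite ltnS leq_eqVlt => /orP[/eqP->|]; first exact: h1.
exact: h0.
Qed.

Lemma injective_unbounded (R : nat -> nat -> Prop) :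
  (forall x x' y, R x y -> R x' y -> x = x') ->
  forall m, exists n, forall x y, n <= x -> R x y -> m <= y.
Proof.
move=> inj; elim=> [|m [n hn]]; first by exists 0.
case: (classic (exists x, R x m)) => [[x0 h0]|nex].
  exists (maxn n x0.+1) => x y; rewrite geq_max => /andP[nx x0x] h.
  rewrite ltn_neqAle (hn _ _ nx h) andbT; apply/negP => /eqP e.
  by rewrite -e in h; rewrite (inj _ _ _ h h0) ltnn in x0x.
exists n => x y nx h; rewrite ltn_neqAle (hn _ _ nx h) andbT.
by apply/negP => /eqP e; case: nex; exists x; rewrite e.
Qed.

(** Each value that is taken finitely often has a last occurrence, and only
finitely many values are possible. *)
Lemma recurrent (T : nat -> nat) N : (forall s, T s < N) -> exists s0,
  forall b, s0 <= b -> forall s, exists2 s', s <= s' & T s' = T b.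
Proof.
move=> TN.
have [s0 h0] : exists s0, forall b t, s0 <= b -> t < N ->
    T b = t -> forall s, exists2 s', s <= s' & T s' = t.
  apply: (@eventually_bound (fun t b =>
      T b = t -> forall s, exists2 s', s <= s' & T s' = t)) => t _.
  case: (classic (forall s, exists2 s', s <= s' & T s' = t)) => [h|]; first by exists 0.
  move=> nh; apply: NNPP => nex; apply: nh => s; apply: NNPP => ns.
  apply: nex; exists s => b sb e; case: ns; by exists b.
by exists s0 => b le s; apply: (h0 b (T b) le (TN b)).
Qed.

(** At stage [s] there are two arrangements [LA] and [LB] of the numbers below [s]:
the first is sorted by [lt], and the second is the part of the new order that
has been decided. The isomorphism pairs entries at equal positions. The number
[s] enters [LA] at position [rank s LA] and [LB] at position [slot s LA LB].
Different positions shift the isomorphism in between. *)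
Section Construction.
Variable lt : rel nat.

Definition rank s (LA : seq nat) := count (fun x => lt x s) LA.

(** The test for distinct values stops a program that is not injective from acting
for ever. *)
Definition conv e i s :=
  all (fun x => (0 < phi e x s) && (phi e x s <= s)) (iota 0 i.+1) &&
  all (fun x => all (fun x' => (phi e x s == phi e x' s) ==> (x == x'))
                    (iota 0 i.+1)) (iota 0 i.+1).

(** The pair coded by [i] is tested after [s] has entered the first order, as its
adjacency may end at this very moment. *)
Definition alive i s LA := next_in (ins (rank s LA) s LA) (pfst i) (psnd i).

Definition value e x s := (phi e x s).-1.

(** A requirement is met once it has won a true adjacency. *)
Definition won e i s LA LB :=
  alive i s LA && ~~ next_in LB (value e (pfst i) s) (value e (psnd i) s).

Definition place e i s LB := (index (value e (pfst i) s) LB).+1.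

Definition prot e (u : nat * nat) := (u.1 < e) || (u.2 < e).

(** Requirement [e] wants [s] to enter the second order right after the image of
[pfst i]. As no pair up to [i] may be won, a true adjacency that has been won
stops [e] from using larger pairs for ever, whereas a spurious one does not
block smaller pairs. The last condition respects the numbers below [e]. *)
Definition act e i s LA LB :=
  [&& conv e i s, alive i s LA,
      all (fun j => ~~ won e j s LA LB) (iota 0 i.+1) &
      ~~ has (prot e) (seg (rank s LA) (place e i s LB) (zip LA LB))].

Definition wants e s LA LB := has (fun i => act e i s LA LB) (iota 0 s).

Definition leader s LA LB := least_below (fun e => wants e s LA LB) s.
Definition target s LA LB := least_below (fun i => act (leader s LA LB) i s LA LB) s.

Definition slot s LA LB :=
  if has (fun e => wants e s LA LB) (iota 0 s)
  then place (leader s LA LB) (target s LA LB) s LB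
  else rank s LA.

Definition stage n := foldl (fun z s =>
  (ins (rank s z.1) s z.1, ins (slot s z.1 z.2) s z.2)) ([::], [::]) (iota 0 n).

Definition LA n := (stage n).1.
Definition LB n := (stage n).2.

Definition ltB (x y : nat) := index x (LB (x + y).+1) < index y (LB (x + y).+1).

Section Computability.
Hypothesis cmp_lt : cmp (fun z : nat * nat => lt z.1 z.2).

Lemma cmp_phi' X {eX : encodable X} (a b c : X -> nat) :
  cmp a -> cmp b -> cmp c -> cmp (fun x => phi (a x) (b x) (c x)).
Proof.
move=> ha hb hc.
apply: (cmp_comp (g := fun z : nat * nat * nat => phi z.1.1 z.1.2 z.2) cmp_phi
  (f := fun x => (a x, b x, c x))); cmp_auto.
Qed.

Lemma cmp_ins X {eX : encodable X} (p x : X -> nat) L :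
  cmp p -> cmp x -> cmp L -> cmp (fun z => ins (p z) (x z) (L z)).
Proof. by move=> hp hx hL; rewrite /ins; cmp_auto. Qed.

Lemma cmp_rank X {eX : encodable X} (s : X -> nat) L :
  cmp s -> cmp L -> cmp (fun z => rank (s z) (L z)).
Proof.
move=> hs hL; rewrite /rank; cmp_auto; apply: (cmp_comp2 (h := lt)) => //; cmp_auto.
by apply: (cmp_comp hs); cmp_auto.
Qed.

Lemma cmp_next_in X {eX : encodable X} (x y : X -> nat) L :
  cmp L -> cmp x -> cmp y -> cmp (fun z => next_in (L z) (x z) (y z)).
Proof. by move=> hL hx hy; rewrite /next_in; cmp_auto. Qed.

Lemma cmp_conv : cmp (fun z : nat * nat * nat => conv z.1.1 z.1.2 z.2).
Proof. by rewrite /conv; cmp_auto; apply: cmp_phi'; cmp_auto. Qed.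

Lemma cmp_alive : cmp (fun z : nat * nat * seq nat => alive z.1.1 z.1.2 z.2).
Proof.
by rewrite /alive; apply: cmp_next_in; [apply: cmp_ins; [apply: cmp_rank|..]|..]; cmp_auto.
Qed.

Lemma cmp_value X {eX : encodable X} (a b c : X -> nat) :
  cmp a -> cmp b -> cmp c -> cmp (fun x => value (a x) (b x) (c x)).
Proof. by move=> ha hb hc; rewrite /value; cmp_auto; apply: cmp_phi'. Qed.

(** The arguments [e], [i], [s], [LA], [LB] of the predicates above. *)
Let args := (nat * nat * (nat * (seq nat * seq nat)))%type.

Lemma cmp_won :
  cmp (fun z : args => won z.1.1 z.1.2 z.2.1 z.2.2.1 z.2.2.2).
Proof.
rewrite /won; cmp_auto.
  apply: (cmp_comp (g := fun z : nat * nat * seq nat => alive z.1.1 z.1.2 z.2) cmp_alive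
    (f := fun z : args => (z.1.2, z.2.1, z.2.2.1))); cmp_auto.
by apply: cmp_next_in; cmp_auto; apply: cmp_value; cmp_auto.
Qed.

Lemma cmp_act :
  cmp (fun z : args => act z.1.1 z.1.2 z.2.1 z.2.2.1 z.2.2.2).
Proof.
rewrite /act; cmp_auto.
- apply: (cmp_comp (g := fun z : nat * nat * nat => conv z.1.1 z.1.2 z.2) cmp_conv
    (f := fun z : args => (z.1.1, z.1.2, z.2.1))); cmp_auto.
- apply: (cmp_comp (g := fun z : nat * nat * seq nat => alive z.1.1 z.1.2 z.2) cmp_alive
    (f := fun z : args => (z.1.2, z.2.1, z.2.2.1))); cmp_auto.
- apply: (cmp_comp (g := fun z : args => won z.1.1 z.1.2 z.2.1 z.2.2.1 z.2.2.2) cmp_won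
    (f := fun z : args * nat => ((z.1.1.1, z.2), z.1.2))); cmp_auto.
- by rewrite /prot; cmp_auto.
- have cpos : cmp (fun z : args => rank z.2.1 z.2.2.1) by apply: cmp_rank; cmp_auto.
  have cplace : cmp (fun z : args => place z.1.1 z.1.2 z.2.1 z.2.2.2).
    by rewrite /place; cmp_auto; apply: cmp_value; cmp_auto.
  by rewrite /seg; cmp_auto; apply: (cmp_zip 0 0); cmp_auto.
Qed.

Lemma cmp_slot :
  cmp (fun z : nat * (seq nat * seq nat) => slot z.1 z.2.1 z.2.2).
Proof.
have cwants X (eX : encodable X) (e : X -> nat) (w : X -> nat * (seq nat * seq nat)) :
    cmp e -> cmp w -> cmp (fun x => wants (e x) (w x).1 (w x).2.1 (w x).2.2).
  move=> he hw; rewrite /wants; cmp_auto.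
  apply: (cmp_comp (g := fun z : args => act z.1.1 z.1.2 z.2.1 z.2.2.1 z.2.2.2) cmp_act
    (f := fun z => (e z.1, z.2, w z.1))); cmp_auto.
    by apply: (cmp_comp he); cmp_auto.
  by apply: (cmp_comp hw); cmp_auto.
have cleader : cmp (fun z : nat * (seq nat * seq nat) => leader z.1 z.2.1 z.2.2).
  rewrite /leader /least_below; cmp_auto.
  by apply: (cwants _ _ snd fst); cmp_auto.
have ctarget : cmp (fun z : nat * (seq nat * seq nat) => target z.1 z.2.1 z.2.2).
  rewrite /target /least_below; cmp_auto.
  apply: (cmp_comp (g := fun z : args => act z.1.1 z.1.2 z.2.1 z.2.2.1 z.2.2.2) cmp_act
    (f := fun z : nat * (seq nat * seq nat) * nat =>
            (leader z.1.1 z.1.2.1 z.1.2.2, z.2, z.1))); cmp_auto.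
  by apply: (cmp_comp cleader); cmp_auto.
rewrite /slot; cmp_auto.
- by apply: (cwants _ _ snd fst); cmp_auto.
- by rewrite /place; cmp_auto; apply: cmp_value; cmp_auto.
- by apply: cmp_rank; cmp_auto.
Qed.

Lemma cmp_ltB : cmp (fun z : nat * nat => ltB z.1 z.2).
Proof.
have cstage : cmp stage.
  apply: (cmp_foldl (g := fun (_ : nat) (z : seq nat * seq nat) s =>
    (ins (rank s z.1) s z.1, ins (slot s z.1 z.2) s z.2))); cmp_auto.
  - by apply: cmp_ins; [apply: cmp_rank|..]; cmp_auto.
  - apply: cmp_ins; cmp_auto.
    apply: (cmp_comp cmp_slot
      (f := fun z : nat * (seq nat * seq nat * nat) => (z.2.2, z.2.1))); cmp_auto.
  - by apply: (cmp_iota (n := id)); apply: cmp_id.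
by rewrite /ltB /LB; cmp_auto; apply: (cmp_comp cstage); cmp_auto.
Qed.

End Computability.

Hypothesis lt_irr : irreflexive lt.
Hypothesis lt_trans : transitive lt.
Hypothesis lt_total : forall x y, x != y -> lt x y || lt y x.

Lemma prot_mono e e' u : e <= e' -> prot e u -> prot e' u.
Proof. by rewrite /prot => le /orP[]/leq_trans/(_ le)->; rewrite ?orbT. Qed.

Lemma convP e i s x : conv e i s -> x <= i ->
  Phi e x (value e x s) /\ value e x s < s.
Proof.
case/andP=> /allP h _ xi; have /h/andP[h0 h1] : x \in iota 0 i.+1.
  by rewrite mem_iota.
by rewrite /value prednK //; split=> //; exists s; rewrite prednK.
Qed.

Lemma conv_inj e i s x x' y : conv e i s -> x <= i -> x' <= i ->
  Phi e x y -> Phi e x' y -> x = x'.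
Proof.
move=> cv xi xi' hx hx'; have [px _] := convP cv xi; have [px' _] := convP cv xi'.
case/andP: cv => /allP h /allP h'.
have mx z : z <= i -> z \in iota 0 i.+1 by rewrite mem_iota.
have /andP[x0 _] := h x (mx _ xi); have /andP[x0' _] := h x' (mx _ xi').
have /allP/(_ x' (mx _ xi'))/implyP := h' x (mx _ xi).
by rewrite (Phi_phi hx x0) (Phi_phi hx' x0') eqxx => /(_ isT)/eqP.
Qed.

Let Z n := zip (LA n) (LB n).
Let q n := slot n (LA n) (LB n).
Let acts e i s := act e i s (LA s) (LB s).
Let wanted e s := wants e s (LA s) (LB s).

Lemma LA_S n : LA n.+1 = ins (rank n (LA n)) n (LA n).
Proof. by rewrite /LA /stage -[n.+1]addn1 iotaD foldl_cat. Qed.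

Lemma LB_S n : LB n.+1 = ins (q n) n (LB n).
Proof. by rewrite /q /LB /stage -[n.+1]addn1 iotaD foldl_cat. Qed.

Lemma perm_LA n : perm_eq (LA n) (iota 0 n).
Proof.
elim: n => // n IH; rewrite LA_S -[n.+1]addn1 iotaD (perm_trans (perm_ins _ _ _)) //.
by rewrite perm_sym -cat1s perm_catC perm_cat2l perm_sym.
Qed.

Lemma perm_LB n : perm_eq (LB n) (iota 0 n).
Proof.
elim: n => // n IH; rewrite LB_S -[n.+1]addn1 iotaD (perm_trans (perm_ins _ _ _)) //.
by rewrite perm_sym -cat1s perm_catC perm_cat2l perm_sym.
Qed.

Lemma mem_LA n x : (x \in LA n) = (x < n).
Proof. by rewrite (perm_mem (perm_LA n)) mem_iota. Qed.
Lemma mem_LB n x : (x \in LB n) = (x < n).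
Proof. by rewrite (perm_mem (perm_LB n)) mem_iota. Qed.
Lemma size_LA n : size (LA n) = n.
Proof. by rewrite (perm_size (perm_LA n)) size_iota. Qed.
Lemma size_LB n : size (LB n) = n.
Proof. by rewrite (perm_size (perm_LB n)) size_iota. Qed.
Lemma uniq_LA n : uniq (LA n).
Proof. by rewrite (perm_uniq (perm_LA n)) iota_uniq. Qed.
Lemma uniq_LB n : uniq (LB n).
Proof. by rewrite (perm_uniq (perm_LB n)) iota_uniq. Qed.
Lemma size_AB n : size (LA n) = size (LB n).
Proof. by rewrite size_LA size_LB. Qed.

Lemma rank_le n : rank n (LA n) <= n.
Proof. by rewrite -{3}(size_LA n) count_size. Qed.

Lemma place_le e i s : conv e i s -> place e i s (LB s) <= s.
Proof.
move=> cv; have [_ lt'] := convP cv (pfst_le i).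
by rewrite /place -{3}(size_LB s) index_mem mem_LB.
Qed.

Lemma slotP s :
  (q s = rank s (LA s) /\ forall e, e < s -> ~~ wanted e s) \/ exists e i,
  [/\ acts e i s, wanted e s, q s = place e i s (LB s),
      forall e', e' < s -> wanted e' s -> e <= e' &
      forall i', i' < s -> acts e i' s -> i <= i'].
Proof.
rewrite /q /slot; case: ifP => [/hasP[e0]|/hasPn h]; last first.
  by left; split=> // e es; apply: h; rewrite mem_iota.
rewrite mem_iota => e0s we0; right; exists (leader s (LA s) (LB s)), (target s (LA s) (LB s)).
have [we _] := @least_belowP (fun e => wants e s (LA s) (LB s)) s e0 e0s we0.
have /hasP[i0] := we; rewrite mem_iota => i0s ai0.
pose P i := acts (leader s (LA s) (LB s)) i s.
have [ai _] := @least_belowP P s i0 i0s ai0.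
split=> //.
  by move=> e' e's we'; have [_] := @least_belowP (fun e => wants e s (LA s) (LB s)) s e' e's we'.
by move=> i' i's ai'; have [_] := @least_belowP P s i' i's ai'.
Qed.

Lemma q_le n : q n <= n.
Proof.
case: (slotP n) => [[-> _]|[e [i [/andP[cv _] _ -> _ _]]]]; [exact: rank_le|exact: place_le].
Qed.

Lemma sorted_LA n : pairwise lt (LA n).
Proof.
elim: n => // n IH; rewrite LA_S /ins pairwise_cat /=.
have /andP[/allP hl /allP hr] : all (fun x => lt x n) (take (rank n (LA n)) (LA n)) &&
    all (predC (fun x => lt x n)) (drop (rank n (LA n)) (LA n)).
  apply: count_downset; apply: sub_pairwise IH => x y xy; apply/implyP => yn.
  exact: lt_trans xy yn.
have := IH; rewrite -{1}(cat_take_drop (rank n (LA n)) (LA n)) pairwise_cat.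
case/and3P=> /allrelP h1 -> ->; rewrite !andbT.
have hr' y : y \in drop (rank n (LA n)) (LA n) -> lt n y.
  move=> yd; have /lt_total/orP[|//] : y != n.
    by apply: contraTneq (mem_drop yd) => ->; rewrite mem_LA ltnn.
  by have /= /negP := hr y yd.
apply/andP; split; last by apply/allP.
apply/allrelP => x y xt; rewrite in_cons => /orP[/eqP->|yd]; first exact: hl.
exact: h1.
Qed.

Lemma index_LA n x y : x < n -> y < n ->
  (index x (LA n) < index y (LA n)) = lt x y.
Proof.
have h u v : u < n -> v < n -> index u (LA n) < index v (LA n) -> lt u v.
  move=> un vn iuv; have /(pairwiseP 0) hp := sorted_LA n.
  have := hp _ _ _ _ iuv; rewrite !nth_index ?mem_LA //; apply;
    by rewrite inE index_mem mem_LA.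
move=> xn yn; apply/idP/idP => [|xy]; first exact: h.
case: ltngtP => // [/h|e].
  by move=> /(_ yn xn)/(lt_trans xy); rewrite lt_irr.
by rewrite (index_inj 0 _ _ e) ?mem_LA // lt_irr in xy.
Qed.

Lemma index_LB_old n x : x < n ->
  index x (LB n.+1) = index x (LB n) + (q n <= index x (LB n)).
Proof.
by move=> xn; rewrite LB_S index_ins_old ?mem_LB // neq_ltn xn.
Qed.

Lemma index_LB_new n : index n (LB n.+1) = q n.
Proof. by rewrite LB_S index_ins_new ?mem_LB ?ltnn // size_LB q_le. Qed.

Lemma index_LB_mono n m x y : x < n -> y < n -> n <= m ->
  (index x (LB m) < index y (LB m)) = (index x (LB n) < index y (LB n)).
Proof.
move=> xn yn; elim: m => [|m IH]; first by case: n xn {yn}.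
rewrite leq_eqVlt => /orP[/eqP<- //|nm]; rewrite -(IH nm).
rewrite !index_LB_old ?(leq_trans xn nm) ?(leq_trans yn nm) //.
by case: (leqP (q m) (index x _)); case: (leqP (q m) (index y _)) => /=; lia.
Qed.

Lemma index_LB n x y : x < n -> y < n ->
  (index x (LB n) < index y (LB n)) = ltB x y.
Proof.
move=> xn yn; rewrite /ltB; case: (leqP n (x + y).+1) => le.
  by rewrite (index_LB_mono xn yn le).
by rewrite (index_LB_mono _ _ (ltnW le)) // ltnS ?leq_addr ?leq_addl.
Qed.

Lemma ltB_irr : irreflexive ltB.
Proof. by move=> x; rewrite /ltB ltnn. Qed.

Lemma ltB_trans : transitive ltB.
Proof.
move=> y x z; have [n [xn yn zn]] : exists n, [/\ x < n, y < n & z < n].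
  by exists (x + y + z).+1; split; lia.
rewrite -!(@index_LB n) //; exact: ltn_trans.
Qed.

Lemma ltB_total x y : x != y -> ltB x y || ltB y x.
Proof.
have xn : x < (x + y).+1 by rewrite ltnS leq_addr.
have yn : y < (x + y).+1 by rewrite ltnS leq_addl.
move=> ne; rewrite -!(@index_LB (x + y).+1) // -neq_ltn.
by apply: contraNneq ne => e; rewrite (index_inj 0 _ _ e) ?mem_LB.
Qed.

(** ** Stabilization of the correspondence *)

(** The requirements stronger than [e] are content from stage [s0] on. *)
Definition quiet e s0 := forall s e', s0 <= s -> e' < e -> ~~ wanted e' s.

Lemma quiet_seg e s0 s : quiet e s0 -> s0 <= s ->
  ~~ has (prot e) (seg (rank s (LA s)) (q s) (Z s)).
Proof.
move=> qu le; case: (slotP s) => [[-> _]|[e1 [i [a1 w1 -> _ _]]]].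
  by rewrite /seg subnn addn0 take0.
have e1e : e <= e1 by rewrite leqNgt; apply/negP => /(qu s _ le); rewrite w1.
case/and4P: a1 => _ _ _; apply: contra => /hasP[u us pu]; apply/hasP; exists u => //.
exact: prot_mono pu.
Qed.

Lemma quiet_step e s0 s : quiet e s0 -> s0 <= s -> e <= s ->
  filter (prot e) (Z s.+1) = filter (prot e) (Z s) /\
  count (prot e) (take (q s).+1 (Z s.+1)) = count (prot e) (take (rank s (LA s)) (Z s)).
Proof.
move=> qu le es; rewrite /Z LA_S LB_S.
apply: (@ins_zip (fun x => x < e)).
- exact: size_AB.
- by rewrite size_LA rank_le.
- by rewrite size_LA q_le.
- by rewrite ltnNge es.
- exact: quiet_seg qu le.
Qed.

Lemma quiet_filter e s0 s s' : quiet e s0 -> s0 <= s -> e <= s -> s <= s' ->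
  filter (prot e) (Z s') = filter (prot e) (Z s).
Proof.
move=> qu h1 h2; elim: s' => [|n IH]; first by rewrite leqn0 => /eqP->.
rewrite leq_eqVlt => /orP[/eqP-> //|le]; rewrite -(IH le).
exact: (quiet_step qu (leq_trans h1 le) (leq_trans h2 le)).1.
Qed.

(** The interval of the protected numbers in which [b] lies is identified by the
number of protected pairs up to [b]. It does not depend on the stage, since the
protected pairs and the second order on old elements do not change. *)
Lemma quiet_count e s0 s b : quiet e s0 -> s0 <= s -> e <= s -> b < s ->
  count (prot e) (take (index b (LB s)).+1 (Z s)) =
  count (fun u => ~~ ltB b u.2) (filter (prot e) (Z (maxn s0 e))).
Proof.
move=> qu h1 h2 bs.
rewrite -(quiet_filter qu _ _ (s := maxn s0 e) (s' := s)) ?leq_maxl ?leq_maxr ?geq_max ?h1 //.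
rewrite count_filter count_take_zip ?size_AB ?uniq_LB //.
apply: eq_in_count => u uZ /=; rewrite andbC ltnS leqNgt; congr (~~ _ && _).
rewrite index_LB //.
have : u.2 \in unzip2 (Z s) by apply: map_f.
by rewrite unzip2_zip ?size_AB // mem_LB.
Qed.

(** This number is determined by the place where [s] enters the first order. *)
Lemma quiet_count_new e s0 s : quiet e s0 -> s0 <= s -> e <= s ->
  count (prot e) (take (rank s (LA s)) (Z s)) =
  count (fun u => ~~ ltB s u.2) (filter (prot e) (Z (maxn s0 e))).
Proof.
move=> qu h1 h2; rewrite -(quiet_step qu h1 h2).2 -index_LB_new.
by apply: quiet_count => //; [exact: leqW|exact: leqW].
Qed.

(** ** Adjacencies *)

Definition adj x y := lt x y /\ forall z, ~~ (lt x z && lt z y).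

Lemma adj_next_in x y n : adj x y -> x < n -> y < n -> next_in (LA n) x y.
Proof.
case=> xy hz xn yn; rewrite /next_in eqn_leq.
have ixy : index x (LA n) < index y (LA n) by rewrite index_LA.
rewrite ixy andbT leqNgt; apply/negP => lt2.
have szy : index y (LA n) < n by rewrite -{2}(size_LA n) index_mem mem_LA.
set k := (index x (LA n)).+1 in lt2.
have ks : k < size (LA n) by rewrite size_LA (ltn_trans lt2).
have zn : nth 0 (LA n) k < n by rewrite -mem_LA mem_nth.
case/negP: (hz (nth 0 (LA n) k)); rewrite -!(@index_LA n) // index_uniq ?uniq_LA //.
by rewrite ltnSn.
Qed.

Lemma not_adj x y : ~ adj x y -> exists n0, forall n, n0 <= n -> ~~ next_in (LA n) x y.
Proof.
move=> na; case: (boolP (lt x y)) => xy; last first.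
  exists (x + y).+1 => n le; apply: contra xy => /eqP h.
  by rewrite -(@index_LA n) ?h //; lia.
have [z /andP[xz zy]] : exists z, lt x z && lt z y.
  by apply: NNPP => nz; apply: na; split=> // z; apply/negP => hz; apply: nz; exists z.
exists (x + y + z).+1 => n le; rewrite /next_in.
have : index x (LA n) < index z (LA n) by rewrite index_LA //; lia.
have : index z (LA n) < index y (LA n) by rewrite index_LA //; lia.
by move=> h1 h2; rewrite neq_ltn (leq_ltn_trans h2 h1) orbT.
Qed.

Lemma alive_LA i s : alive i s (LA s) = next_in (LA s.+1) (pfst i) (psnd i).
Proof. by rewrite /alive LA_S. Qed.

Lemma LB_nonadj_mono n m x y : x < n -> y < n -> n <= m ->
  next_in (LB m) x y -> next_in (LB n) x y.
Proof.
move=> xn yn; elim: m => [|m IH]; first by case: n xn {yn}.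
rewrite leq_eqVlt => /orP[/eqP<- //|nm] h; apply: (IH nm); move: h.
rewrite LB_S; apply: next_in_ins; rewrite mem_LB ?ltnn ?(leq_trans xn nm) ?(leq_trans yn nm) //.
Qed.

Lemma acted e i s : acts e i s -> q s = place e i s (LB s) ->
  forall n, s < n -> ~~ next_in (LB n) (value e (pfst i) s) (value e (psnd i) s).
Proof.
case/and4P=> cv al /allP nw _ qE n sn.
have [_ b1] := convP cv (pfst_le i); have [_ b2] := convP cv (psnd_le i).
have /nw : i \in iota 0 i.+1 by rewrite mem_iota add0n ltnSn leq0n.
rewrite /won al /= negbK => /eqP h.
apply/negP => /(LB_nonadj_mono (leqW b1) (leqW b2) sn).
rewrite /next_in !index_LB_old // qE /place h ltnn leqnn addn0 addn1.
by rewrite eqn_leq ltnn.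
Qed.

(** After the action, pair [i] is won or no longer adjacent, both for ever. *)
Lemma acts_once e i s s' : acts e i s -> q s = place e i s (LB s) -> s < s' ->
  ~~ acts e i s'.
Proof.
move=> a1 qE ss'; have := acted a1 qE ss'; case/and4P: a1 => cv _ _ _.
apply: contra => /and4P[cv' al' /allP nw' _].
have im x : x <= i -> value e x s = value e x s'.
  by move=> xi; apply: Phi_fun (convP cv xi).1 (convP cv' xi).1.
rewrite !im ?pfst_le ?psnd_le //.
have /nw' : i \in iota 0 i.+1 by rewrite mem_iota add0n ltnSn leq0n.
by rewrite /won al' /= negbK.
Qed.

(** ** Every requirement is met *)

Hypothesis inf_adj : forall n, exists x y, n <= x /\ adj x y.

(** Infinitely many true adjacencies [(x, y)] have their images in the finitely
many intervals of the protected numbers; choose one whose interval is entered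
again and again. When all pairs up to the code [k] of [(x, y)] have settled and
the interval is entered again, either one of these pairs has been won, or [e]
is able to act on [k]. Then [e], being the strongest active requirement, acts
on a pair up to [k]; this pair is a true adjacency as well, and is won. *)
Lemma diagonal e s0 : quiet e s0 -> (forall x, exists y, Phi e x y) ->
  (forall x x' y, Phi e x y -> Phi e x' y -> x = x') ->
  exists x y b b' n, [/\ adj x y, Phi e x b, Phi e y b', b < n /\ b' < n &
                         ~~ next_in (LB n) b b'].
Proof.
move=> qu tot inj.
pose T b := count (fun u => ~~ ltB b u.2) (filter (prot e) (Z (maxn s0 e))).
have [s1 rec] : exists s1, forall b, s1 <= b ->
    forall s, exists2 s', s <= s' & T s' = T b.
  by apply: (@recurrent _ (size (filter (prot e) (Z (maxn s0 e)))).+1) => b; rewrite ltnS count_size.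
have [n0 hn0] := injective_unbounded inj s1.
have [x [y [n0x adjxy]]] := inf_adj n0.
have [b xb] := tot x; have s1b := hn0 _ _ n0x xb.
pose k := pairn x y.
have [n1 h1] : exists n1, forall s z, n1 <= s -> z < k.+1 ->
    exists v, [/\ Phi e z v, phi e z s = v.+1 & v < s].
  apply: (@eventually_bound (fun z s => exists v, [/\ Phi e z v, phi e z s = v.+1 & v < s])) => z _.
  have [v zv] := tot z; have [m hm] := Phi_limit zv; exists (maxn m v.+1) => s.
  by rewrite geq_max => /andP[/hm ms vs]; exists v.
have [n2 h2] : exists n2, forall s j, n2 <= s -> j < k.+1 ->
    adj (pfst j) (psnd j) \/ ~~ next_in (LA s) (pfst j) (psnd j).
  apply: (@eventually_bound (fun j s => adj (pfst j) (psnd j) \/ ~~ next_in (LA s) (pfst j) (psnd j))) => j _.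
  case: (classic (adj (pfst j) (psnd j))) => [a|/not_adj[m hm]]; first by exists 0; left.
  by exists m => s /hm; right.
have [s les Ts] := rec b s1b (s0 + e.+1 + n1 + n2 + k.+1 + b.+1).
have cv : conv e k s.
  have h z : z \in iota 0 k.+1 -> exists v, [/\ Phi e z v, phi e z s = v.+1 & v < s].
    by rewrite mem_iota => /andP[_ zk]; apply: h1 => //; lia.
  apply/andP; split; apply/allP => z /h[v [zv -> vs]]; first by rewrite vs.
  apply/allP => z' /h[v' [zv' -> _]]; apply/implyP => /eqP[e1].
  by apply/eqP; apply: inj zv _; rewrite e1.
have al j : j <= k -> alive j s (LA s) -> adj (pfst j) (psnd j).
  move=> jk; rewrite alive_LA; case: (h2 s.+1 j) => //; first by lia.
  by move/negPf=> ->.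
case: (boolP (all (fun j => ~~ won e j s (LA s) (LB s)) (iota 0 k.+1))) => nw; last first.
  move/allPn: nw => [j]; rewrite mem_iota /= negbK => jk /andP[aj nadj].
  have [c1 d1] := convP cv (leq_trans (pfst_le j) jk).
  have [c2 d2] := convP cv (leq_trans (psnd_le j) jk).
  exists (pfst j), (psnd j), (value e (pfst j) s), (value e (psnd j) s), s; split=> //.
  exact: al.
have ak : acts e k s.
  apply/and4P; split=> //.
    by rewrite alive_LA; apply: adj_next_in; rewrite ?pfst_pair ?psnd_pair //;
      [move: (leq_pair1 x y) | move: (leq_pair2 x y)]; rewrite -/k; lia.
  apply: seg_count; rewrite (quiet_count_new qu) //; try by lia.
  rewrite -/(T s) Ts /place pfst_pair.
  have [-> _] : value e x s = b /\ True.
    by split=> //; apply: Phi_fun xb; have [] := convP cv (leq_pair1 x y).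
  by rewrite (quiet_count qu) //; lia.
have we : wanted e s by apply/hasP; exists k; rewrite ?mem_iota //; lia.
have es : e < s by lia.
case: (slotP s) => [[_ /(_ e es)]|[e' [i [ai wi qi emin imin]]]]; first by rewrite we.
have ee : e' = e.
  apply/eqP; rewrite eqn_leq emin //= leqNgt; apply/negP => lt'.
  by have := qu s e' _ lt'; rewrite wi => h; have : false by apply: h; lia.
subst e'; have ik : i <= k by apply: imin => //; lia.
have [ci al_i _ _] := and4P ai.
have [c1 d1] := convP ci (pfst_le i); have [c2 d2] := convP ci (psnd_le i).
exists (pfst i), (psnd i), (value e (pfst i) s), (value e (psnd i) s), s.+1; split=> //.
- exact: al.
- by split; apply: leqW.
- exact: (acted ai qi).
Qed.

(** If [e] does not compute an injection, the pairs for which [conv] holds are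
bounded; if it does, they are bounded by a true adjacency that has been won. *)
Lemma quiet_bound e s0 : quiet e s0 ->
  exists d s1, forall s i, s1 <= s -> acts e i s -> i < d.
Proof.
move=> qu.
case: (classic (forall x, exists y, Phi e x y)) => [tot|]; last first.
  move=> /not_all_ex_not[x nx]; exists x, 0 => s i _ /and4P[cv _ _ _].
  rewrite ltnNge; apply/negP => xi; apply: nx.
  by exists (value e x s); have [] := convP cv xi.
case: (classic (forall x x' y, Phi e x y -> Phi e x' y -> x = x')) => [inj|ninj].
  have [x [y [b [b' [n [axy xb yb [bn bn'] nadj]]]]]] := diagonal qu tot inj.
  exists (pairn x y), (n + (x + y).+1) => s i le /and4P[cv al /allP nw _].
  rewrite ltnNge; apply/negP => ki.
  have /nw : pairn x y \in iota 0 i.+1 by rewrite mem_iota.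
  rewrite /won alive_LA pfst_pair psnd_pair adj_next_in //=; try by lia.
  have v z c : Phi e z c -> z <= pairn x y -> value e z s = c.
    by move=> zc zi; apply: Phi_fun zc; have [] := convP cv (leq_trans zi ki).
  rewrite negbK (v _ _ xb (leq_pair1 x y)) (v _ _ yb (leq_pair2 x y)).
  move/(LB_nonadj_mono bn bn'); rewrite (negPf nadj).
  by move=> h; have : false by apply: h; lia.
have [x [x' [y [xy xy' ne]]]] : exists x x' y, [/\ Phi e x y, Phi e x' y & x <> x'].
  apply: NNPP => nex; apply: ninj => x x' y xy xy'; apply: NNPP => ne.
  by apply: nex; exists x, x', y.
exists (x + x'), 0 => s i _ /and4P[cv _ _ _]; rewrite ltnNge; apply/negP => le.
by apply: ne; apply: (conv_inj cv _ _ xy xy'); lia.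
Qed.

Lemma quiet_ex e : exists s0, quiet e s0.
Proof.
elim: e => [|e [s0 qu]]; first by exists 0.
have [d [s1 h1]] := quiet_bound qu.
have [s2 h2] : exists s2, forall s i, s2 <= s -> i < d ->
    ~ (acts e i s /\ q s = place e i s (LB s)).
  apply: (@eventually_bound (fun i s => ~ (acts e i s /\ q s = place e i s (LB s)))) => i _.
  case: (classic (exists s, acts e i s /\ q s = place e i s (LB s))) => [[s [a qs]]|nex].
    by exists s.+1 => s' /(acts_once a qs)/negP na [].
  by exists 0 => s _ h; apply: nex; exists s.
exists (s0 + s1 + s2 + e.+1) => s e' le; rewrite ltnS leq_eqVlt => /orP[/eqP->|]; last first.
  by apply: qu; lia.
apply/negP => we; have es : e < s by lia.
case: (slotP s) => [[_ /(_ e es)]|[e1 [i [ai wi qi emin _]]]]; first by rewrite we.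
have ee : e1 = e.
  apply/eqP; rewrite eqn_leq emin //= leqNgt; apply/negP => lt'.
  by have := qu s e1 _ lt'; rewrite wi => h; have : false by apply: h; lia.
subst e1; case: (h2 s i) => //; first by lia.
by apply: h1 ai; lia.
Qed.

(** ** The limit isomorphism *)

(** Once the requirements stronger than [e] are quiet, the isomorphism and its
inverse do not change at numbers below [e]. *)
Lemma limit_pair e : exists s0, forall u s s', prot e u -> s0 <= s -> s0 <= s' ->
  u \in Z s -> u \in Z s'.
Proof.
have [s0 qu] := quiet_ex e; exists (s0 + e) => u s s' pu le le' us.
have E n : s0 + e <= n -> filter (prot e) (Z n) = filter (prot e) (Z (s0 + e)).
  by move=> h; apply: (quiet_filter qu); lia.
have : u \in filter (prot e) (Z s) by rewrite mem_filter pu.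
by rewrite E // -(E s') // mem_filter => /andP[].
Qed.

Definition limit u := exists s0, forall s, s0 <= s -> u \in Z s.

Lemma limit_l x : exists y, limit (x, y).
Proof.
have [s0 h] := limit_pair x.+1; pose s := s0 + x.+1.
have xs : x \in LA s by rewrite mem_LA; lia.
exists (nth 0 (LB s) (index x (LA s))), s => s' le.
apply: (h _ s) => //=; [by rewrite /prot /= ltnSn|by lia|by lia|].
apply/(nthP (0, 0)); exists (index x (LA s)).
  by rewrite size_zip -size_AB minnn index_mem.
by rewrite nth_zip ?size_AB // nth_index.
Qed.

Lemma limit_r y : exists x, limit (x, y).
Proof.
have [s0 h] := limit_pair y.+1; pose s := s0 + y.+1.
have ys : y \in LB s by rewrite mem_LB; lia.
exists (nth 0 (LA s) (index y (LB s))), s => s' le.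
apply: (h _ s) => //=; [by rewrite /prot /= ltnSn orbT|by lia|by lia|].
apply/(nthP (0, 0)); exists (index y (LB s)).
  by rewrite size_zip size_AB minnn index_mem.
by rewrite nth_zip ?size_AB // nth_index.
Qed.

Lemma mem_Z s u : u \in Z s ->
  [/\ u.1 < s, u.2 < s & index u.1 (LA s) = index u.2 (LB s)].
Proof.
case/(nthP (0, 0)) => i; rewrite size_zip -size_AB minnn size_LA => i_s <-.
rewrite nth_zip ?size_AB //= -mem_LA -mem_LB !mem_nth ?size_LA ?size_LB //.
by rewrite !index_uniq ?uniq_LA ?uniq_LB ?size_LA ?size_LB.
Qed.

Lemma limit_mono u v : limit u -> limit v -> ltB u.2 v.2 = lt u.1 v.1.
Proof.
move=> [s0 hu] [s1 hv]; pose s := s0 + s1.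
have /mem_Z[u1 u2 eu] := hu s (leq_addr _ _).
have /mem_Z[v1 v2 ev] := hv s (leq_addl _ _).
by rewrite -(index_LB u2 v2) -(index_LA u1 v1) eu ev.
Qed.

Lemma limit_iso : exists f : nat -> nat,
  (forall x y, ltB (f x) (f y) = lt x y) /\ (forall y, exists x, f x = y).
Proof.
pose f x := proj1_sig (constructive_indefinite_description _ (limit_l x)).
have fP x : limit (x, f x) := proj2_sig (constructive_indefinite_description _ (limit_l x)).
exists f; split=> [x y|y]; first exact: (limit_mono (fP x) (fP y)).
have [x xy] := limit_r y; exists x; apply/eqP; apply/negPn/negP => /ltB_total.
by rewrite (limit_mono (fP x) xy) (limit_mono xy (fP x)) lt_irr.
Qed.

(** An isomorphism preserves adjacency, and so [diagonal] excludes that one of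
them is computed by some [e]. *)
Lemma no_computable_iso f : cnat f -> (forall x y, ltB (f x) (f y) = lt x y) ->
  (forall y, exists x, f x = y) -> False.
Proof.
move=> cf fm fs; have [e he] := Phi_univ cf; have [s0 qu] := quiet_ex e.
have finj x x' : f x = f x' -> x = x'.
  move=> E; apply/eqP; apply/negPn/negP => /lt_total.
  by rewrite -!fm E ltB_irr.
have [||x [y [b [b' [n [[xy hz] xb yb [bn bn'] nadj]]]]]] := diagonal qu.
- by move=> x; exists (f x).
- by move=> x x' y xy xy'; apply: finj; rewrite (Phi_fun (he x) xy) (Phi_fun (he x') xy').
rewrite -(Phi_fun (he x) xb) in bn nadj; rewrite -(Phi_fun (he y) yb) in bn' nadj.
case/negP: nadj; rewrite /next_in eqn_leq.
have ixy : index (f x) (LB n) < index (f y) (LB n) by rewrite index_LB // fm.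
rewrite ixy andbT leqNgt; apply/negP => lt2.
have szy : index (f y) (LB n) < n by rewrite -{2}(size_LB n) index_mem mem_LB.
set k := (index (f x) (LB n)).+1 in lt2.
have ks : k < size (LB n) by rewrite size_LB (ltn_trans lt2).
have zn : nth 0 (LB n) k < n by rewrite -mem_LB mem_nth.
have [z ez] := fs (nth 0 (LB n) k).
case/negP: (hz z); rewrite -!fm ez -!(@index_LB n) // index_uniq ?uniq_LB //.
by rewrite ltnSn.
Qed.

End Construction.

(** * Computably categorical orders are almost dense *)

(** A point that is not a two-sided limit is least, greatest, or in an adjacency,
and each point has at most one predecessor and one successor. Hence bounded
adjacencies leave finitely many exceptional points. *)
Lemma almost_dense_or_adj A : almost_dense A \/
  forall n, exists x y, n <= x /\ adj (prec A) x y.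
Proof.
case: (classic (forall n, exists x y, n <= x /\ adj (prec A) x y)) => [|nadj]; [by right|left].
have [n hn] : exists n, forall x y, adj (prec A) x y -> x < n.
  apply: NNPP => h; apply: nadj => n; apply: NNPP => nex; apply: h; exists n => x y a.
  by rewrite ltnNge; apply/negP => nx; apply: nex; exists x, y.
pose succ x y := adj (prec A) x y.
have succ_fun x y y' : succ x y -> succ x y' -> y = y'.
  move=> [xy h] [xy' h']; case: (prec_cmp (prec_r xy) (prec_r xy')) => // l.
    by have := h' y; rewrite xy l.
  by have := h y'; rewrite xy' l.
have succ_inj x x' y : succ x y -> succ x' y -> x = x'.
  move=> [xy h] [xy' h']; case: (prec_cmp (prec_l xy) (prec_l xy')) => // l.
    by have := h x'; rewrite xy' l.
  by have := h' x; rewrite xy l.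
have [s hs] : fin (fun x => carrier A x /\ ~ two_sided A x).
  apply: (@fin_sub _ (fun x =>
    ((carrier A x /\ ~ exists y, prec A y x) \/ (carrier A x /\ ~ exists y, prec A x y)) \/
    ((exists2 y, y \in iota 0 n & succ y x) \/ (exists2 z, z \in iota 0 n & x = z)))).
    move=> x [cx nx]; apply: NNPP => /not_or_and[/not_or_and[h1 h2] /not_or_and[h3 h4]].
    apply: nx; split.
    - by apply: NNPP => h; apply: h1.
    - by apply: NNPP => h; apply: h2.
    - move=> y yx; apply: NNPP => h; apply: h3.
      have a : succ y x.
        by split=> // z; apply/negP => /andP[yz zx]; apply: h; exists z.
      by exists y; rewrite // mem_iota (hn y x).
    - move=> y xy; apply: NNPP => h; apply: h4.
      have a : succ x y.
        by split=> // z; apply/negP => /andP[xz zy]; apply: h; exists z.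
      by exists x; rewrite // mem_iota (hn x y).
  apply: fin_or; apply: fin_or.
  - apply: fin_unique => x y [cx nx] [cy ny].
    by case: (prec_cmp cx cy) => // l; [case: ny; exists x|case: nx; exists y].
  - apply: fin_unique => x y [cx nx] [cy ny].
    by case: (prec_cmp cx cy) => // l; [case: nx; exists y|case: ny; exists x].
  - by apply: fin_ex => y; apply: fin_unique => x x'; apply: succ_fun.
  - by apply: fin_ex => z; apply: fin_unique => x x' -> ->.
exists [seq x <- s | carrier A x].
  by move=> x; rewrite mem_filter => /andP[].
move=> x cx xs; apply: NNPP => nx; case/negP: xs.
by rewrite mem_filter cx /=; apply: hs.
Qed.

Section Enumeration.
Variable D : pred nat.
Hypothesis infD : forall n, exists2 x, n <= x & D x.

Definition below x := count D (iota 0 x).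

Lemma below_S x : below x.+1 = below x + D x.
Proof. by rewrite /below -[x.+1]addn1 iotaD count_cat /= addn0. Qed.

Lemma below_mono x y : x <= y -> below x <= below y.
Proof.
by move=> le; rewrite /below -(subnKC le) iotaD count_cat leq_addr.
Qed.

Lemma below_inj x y : D x -> D y -> below x = below y -> x = y.
Proof.
wlog le : x y / x <= y => [hw Dx Dy e|Dx Dy e].
  by case: (leqP x y) => [le|/ltnW le]; [|apply/esym]; apply: hw.
move: le; rewrite leq_eqVlt => /orP[/eqP //|/below_mono].
by rewrite below_S Dx e addn1 ltnn.
Qed.

Lemma ex_enum n : exists x, D x && (below x == n).
Proof.
have [N hN] : exists N, n < below N.
  elim: n => [|n [N hN]].
    have [x _ Dx] := infD 0; exists x.+1; by rewrite below_S Dx addn1.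
  have [x Nx Dx] := infD N; exists x.+1; rewrite below_S Dx addn1 ltnS.
  exact: leq_trans hN (below_mono Nx).
elim: N hN => // N IH; rewrite below_S.
have [h|h] := ltnP n (below N); first by move=> _; apply: IH.
case: (boolP (D N)) => DN; last by rewrite addn0 ltnNge h.
by rewrite addn1 ltnS => h'; exists N; rewrite DN eqn_leq h h'.
Qed.

Definition enumer n := ex_minn (ex_enum n).

Lemma enumerP n : D (enumer n) /\ below (enumer n) = n.
Proof. by rewrite /enumer; case: ex_minnP => x /andP[Dx /eqP]. Qed.

Lemma belowK x : D x -> enumer (below x) = x.
Proof. by move=> Dx; have [h e] := enumerP (below x); apply: below_inj. Qed.

Lemma cmp_enumer : cmp (D : nat -> bool) -> cmp enumer.
Proof.
move=> cD; apply: cmp_search; rewrite /below; cmp_auto.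
  by apply: (cmp_comp cD); cmp_auto.
by apply: (cmp_comp cD); cmp_auto.
Qed.

End Enumeration.

(** The order is transferred to all natural numbers along the increasing
enumeration [en] of its carrier, whose inverse is [below]. *)
Lemma cc_almost_dense A : computable_linorder A -> computably_categorical A ->
  almost_dense A.
Proof.
move=> hA cc; case: (almost_dense_or_adj A) => // unb; exfalso.
have infA n : exists2 x, n <= x & carrier A x.
  by have [x [y [nx [xy _]]]] := unb n; exists x => //; apply: prec_l xy.
pose en := enumer infA; pose lt x y := prec A (en x) (en y).
have enP n : carrier A (en n) := (enumerP infA n).1.
have en_inj : injective en.
  by move=> x y e; rewrite -(enumerP infA x).2 -/en [in LHS]/en -/(en x) e (enumerP infA y).2.
have cen : cmp en by apply: cmp_enumer; apply: cmp_carrier.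
have lt_irr : irreflexive lt by move=> x; apply: prec_irr.
have lt_trans : transitive lt by move=> y x z; apply: prec_trans.
have lt_total x y : x != y -> lt x y || lt y x.
  by move=> ne; apply: prec_total; rewrite ?(inj_eq en_inj) //; apply: enP.
have cmp_lt : cmp (fun z : nat * nat => lt z.1 z.2).
  by rewrite /lt; apply: (cmp_comp2 (cmp_prec hA)); apply: (cmp_comp cen); cmp_auto.
have inf_adj n : exists x y, n <= x /\ adj lt x y.
  have [x [y [nx [xy hz]]]] := unb (en n).
  have ex := belowK infA (prec_l xy); have ey := belowK infA (prec_r xy).
  exists (below (carrier A) x), (below (carrier A) y); split.
    by rewrite -[n](enumerP infA n).2; apply: below_mono.
  by split=> [|z]; rewrite /lt /en ex ey.
pose B := @LinOrder predT (ltB lt) (fun _ _ _ => isT) (@ltB_irr lt)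
  (@ltB_trans lt) (fun x y _ _ => @ltB_total lt x y).
have hB : computable_linorder B.
  split; first by have [p hp] := cnat_const 1; exists p.
  have [g [p hp] eg] := cmp_ltB cmp_lt; have [r hr] := cnat2_pair.
  exists (Comp p [:: r]) => x y; exists [:: pairn x y]; first by split; [exact: hr|].
  by have := hp (pairn x y); rewrite -(eg (x, y)).
have [f [fm fs]] := limit_iso lt_irr lt_trans lt_total inf_adj.
have isof : lin_iso A B (fun x => f (below (carrier A) x)).
  split=> //.
  - move=> x y cx cy e; apply: (below_inj cx cy); apply/eqP/negPn/negP => /lt_total.
    by rewrite -!fm e ltB_irr.
  - move=> y _; have [x <-] := fs y; exists (en x); first exact: enP.
    by rewrite (enumerP infA x).2.
  - by move=> x y cx cy; rewrite /= fm /lt /en !belowK.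
have [g [[g1 g2 g3 g4] [p hp]]] := cc B hB (ex_intro _ _ isof).
apply: (no_computable_iso lt_irr lt_trans lt_total inf_adj (f := fun n => g (en n))).
- have [r hr] : cnat en by apply/cmp_cnat.
  exists (Comp p [:: r]) => x; exists [:: en x]; first by split; [exact: hr|].
  by apply: hp; apply: enP.
- by move=> x y; rewrite -[ltB _ _ _]/(prec B _ _) g4 //; apply: enP.
- move=> y; have [x cx <-] := g3 y isT; exists (below (carrier A) x).
  by rewrite /en belowK.
Qed.

Theorem corollary3p3 (A : linorder) (hA : computable_linorder A) :
  computably_categorical A <-> weakly_ultrahomogeneous A.
Proof.
split=> [/(cc_almost_dense hA)|/wuh_almost_dense].
  exact: almost_dense_wuh.
exact: almost_dense_cc.
Qed.
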